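(* Every positive integer $m$ with $m\geqslant 10^{39}$ is a sum of $8$ dodecahedral numbers.
   Context: For a positive integer $n$, the $n$-th dodecahedral number is $D_n=\frac{n(3n-1)(3n-2)}{2}$. Repetitions are allowed in sums. *)

(* Defs.v *)
From Stdlib Require Import ZArith List Lia.

Open Scope Z_scope.

Definition dodecahedral (n : Z) : Z := n * (3 * n - 1) * (3 * n - 2) / 2.

(* The division in [dodecahedral] is exact. *)
Lemma dodecahedral_double (n : Z) :
  2 * dodecahedral n = n * (3 * n - 1) * (3 * n - 2).
Proof.
  unfold dodecahedral.
  destruct (Z.Even_or_Odd n) as [[k ->] | [k ->]].
  - replace (2 * k * (3 * (2 * k) - 1) * (3 * (2 * k) - 2))
      with (k * (3 * (2 * k) - 1) * (3 * (2 * k) - 2) * 2) by ring.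
    rewrite Z.div_mul by lia. ring.
  - replace ((2 * k + 1) * (3 * (2 * k + 1) - 1) * (3 * (2 * k + 1) - 2))
      with ((2 * k + 1) * (3 * k + 1) * (3 * (2 * k + 1) - 2) * 2) by ring.
    rewrite Z.div_mul by lia. ring.
Qed.

(* Exactly [s] summands, repetitions allowed.  The indices are positive, so
   [dodecahedral 0 = 0] is not available as a summand. *)
Definition sum_of_dodecahedral (s : nat) (m : Z) : Prop :=
  exists l : list Z,
    length l = s /\
    Forall (fun n => 0 < n) l /\
    m = fold_right Z.add 0 (map dodecahedral l).

(* Main.v *)
Require Import Defs.
From Stdlib Require Import ZArith Lia Znumtheory Zpow_facts.
From mathcomp Require all_boot all_order all_algebra all_solvable all_field.
From mathcomp Require zify ring lra.
From mathcomp.real_closed Require realalg.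

(** With [u = 3 n - 1] a dodecahedral number is [(u ^ 3 - u) / 6].  If two indices have
    [u + v = s] and [u - v = 3 e], their dodecahedral numbers add up to
    [(s ^ 3 - 4 s + 27 s e ^ 2) / 24], a quadratic polynomial in [e].  Three pairs with the same
    [s], where [s = 1 mod 6], therefore give [(s ^ 3 - 4 s + 9 s N) / 8], where [N] is a sum of
    three odd squares, and by a theorem of Gauss every positive [N = 3 mod 8] is such a sum.
    So six dodecahedral numbers reach all integers of one residue class modulo [9 s] in an
    interval close to [[s ^ 3 / 8, s ^ 3 / 4]] ([six_dodecahedral]).

    The other two summands have to bring [m] into this class and this interval.  Take
    [s = 7 ^ k] with [s ^ 3 <= m < 343 s ^ 3].  Modulo 7 the derivative of the cubic polynomial
    never vanishes, so its congruences can be solved by Hensel's lemma; a version with two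
    unknowns also prescribes the ratio [g] of the derivatives at the two indices, modulo
    [7 ^ 7] ([starting_pair]).  Then the second index can be increased in steps of
    [Q = s / 7 ^ 7] if the first one is decreased in steps of [g Q] ([progression_of_pairs]).
    As [g] lies between 100 and 145, the steps of the first index are shorter than [s / 5000], and
    the second one stays below [s / 11] while the first runs through a full period: the first
    index can be placed as precisely as the interval demands ([reach_window],
    [window_estimates]).

    For the theorem of Gauss ([three_squares]) it suffices, by the reduction of ternary forms of
    determinant one, to find [q], [t], [b] such that the squarefree number [n = 3 mod 8] divides
    [2 q t ^ 2 + 1] and [4 q] divides [b ^ 2 + n] ([three_squares_of_auxiliary]).  So [- 2 q] has
    to be a square modulo [n], and [- n] a square modulo [q].  Dirichlet's theorem would provide
    a prime [q]; instead, all [q] are counted with the weights [r q], the sum of [(d / n)] over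
    [d | q], and [S q], the product of
    [1 + (- 2 q / p)] over [p | n].  If [r q] is not zero, the primes that divide [q] to an odd
    power have [(p / n) = 1], and by reciprocity [- n] is a square modulo each of them; the
    square part of [q] can be dropped.  If [S q] is not zero and [q] is coprime to [n], then
    [- 2 q] is a square modulo [n].  The sum of [r q * S q / sqrt q] expands into a sum over pairs
    of complementary quadratic characters modulo [n].  When neither character is principal the
    hyperbola method gives a bounded contribution ([hyperbola_bound]), whereas the pair
    containing the principal character contributes at least a divergent harmonic sum, coming
    from square [q].  Hence some [q] has both weights nonzero ([genus_representative]). *)

Open Scope Z_scope.

(** * Ternary quadratic forms of determinant one *)

Lemma centered_remainder (a b : Z) : 0 < a -> exists k, 2 * Z.abs (b + k * a) <= a.
Proof.
  intros ha. exists (- ((2 * b + a) / (2 * a))).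
  pose proof (Z.div_mod (2 * b + a) (2 * a) ltac:(lia)) as E.
  pose proof (Z.mod_pos_bound (2 * b + a) (2 * a) ltac:(lia)) as B.
  set (k := (2 * b + a) / (2 * a)) in *. nia.
Qed.

(** Lagrange reduction, phrased as the existence of a unimodular substitution after
    which the leading coefficient is at most [2 / sqrt 3] times the square root of the
    determinant.  Translating makes [2 |q| <= p]; if then [r < p], swapping the two
    variables decreases the leading coefficient, and otherwise
    [p * p <= p * r <= D + p * p / 4]. *)
Lemma binary_reduction (p q r : Z) : 0 < p -> 0 < p * r - q * q ->
  exists x y u v, x * v - y * u = 1 /\
    0 < p * x * x + 2 * q * x * u + r * u * u /\
    3 * (p * x * x + 2 * q * x * u + r * u * u) ^ 2 <= 4 * (p * r - q * q).
Proof.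
  intros hp. revert q r.
  induction p as [p IH] using (well_founded_induction (Z.lt_wf 0)).
  intros q r hD.
  destruct (centered_remainder p q hp) as [k hk].
  set (q1 := q + k * p) in *.
  set (r1 := r + 2 * k * q + k * k * p).
  assert (E : p * r1 - q1 * q1 = p * r - q * q) by (unfold r1, q1; ring).
  destruct (Z_lt_le_dec r1 p) as [hr | hr].
  - assert (hr0 : 0 < r1) by nia.
    destruct (IH r1 (conj (Z.lt_le_incl _ _ hr0) hr) hr0 (- q1) p ltac:(lia))
      as (x & y & u & v & h1 & h2 & h3).
    exists (k * x - u), (k * y - v), x, y.
    assert (F : p * (k * x - u) * (k * x - u) + 2 * q * (k * x - u) * x + r * x * x
      = r1 * x * x + 2 * (- q1) * x * u + p * u * u) by (unfold r1, q1; ring).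
    rewrite F. repeat split; lia.
  - exists 1, 0, 0, 1.
    replace (p * 1 * 1 + 2 * q * 1 * 0 + r * 0 * 0) with p by ring.
    repeat split; try lia.
    assert (4 * (q1 * q1) <= p * p) by nia. nia.
Qed.

Definition ternary (a b c d e f x y z : Z) : Z :=
  a * x * x + b * y * y + c * z * z + 2 * d * y * z + 2 * e * x * z + 2 * f * x * y.

(** Hermite reduction.  The form [a * F - (a x + f y + e z)^2] is a binary form in [y, z]
    of determinant [a * det F = a]; reducing it makes its leading coefficient
    [p = a * b - f * f] satisfy [3 p^2 <= 4 a].  After a translation [2 |f| <= a] as well.
    If [b < a], exchanging [x] and [y] decreases [a]; otherwise [3 a^2 <= 4 p], hence
    [27 a^3 <= 64] and [a = 1].  A form of determinant one with [a = b = 1], [f = 0] is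
    visibly a sum of three squares. *)
Lemma ternary_unimodular (a b c d e f : Z) : 0 < a -> 0 < a * b - f * f ->
  a * b * c + 2 * d * e * f - a * d * d - b * e * e - c * f * f = 1 ->
  forall x y z, exists X Y Z, ternary a b c d e f x y z = X * X + Y * Y + Z * Z.
Proof.
  intros ha. revert b c d e f.
  induction a as [a IH] using (well_founded_induction (Z.lt_wf 0)).
  intros b c d e f hab hdet x y z.
  assert (hG : (a * b - f * f) * (a * c - e * e) - (a * d - e * f) * (a * d - e * f) = a).
  { transitivity (a * (a * b * c + 2 * d * e * f - a * d * d - b * e * e - c * f * f)).
    - ring.
    - rewrite hdet. ring. }
  destruct (binary_reduction (a * b - f * f) (a * d - e * f) (a * c - e * e) hab
    ltac:(lia)) as (s & t & u & v & h1 & h2 & h3).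
  set (b1 := b * s * s + 2 * d * s * u + c * u * u) in *.
  set (f1 := f * s + e * u) in *.
  set (c1 := b * t * t + 2 * d * t * v + c * v * v) in *.
  set (e1 := f * t + e * v) in *.
  set (d1 := b * s * t + d * (s * v + t * u) + c * u * v) in *.
  destruct (centered_remainder a f1 ha) as [k hk].
  set (f2 := f1 + k * a) in *.
  set (b2 := b1 + 2 * k * f1 + k * k * a) in *.
  set (d2 := d1 + k * e1) in *.
  assert (Ep : (a * b - f * f) * s * s + 2 * (a * d - e * f) * s * u
    + (a * c - e * e) * u * u = a * b2 - f2 * f2) by (unfold b2, f2, b1, f1; ring).
  rewrite Ep, hG in *.
  assert (Edet : a * b2 * c1 + 2 * d2 * e1 * f2 - a * d2 * d2 - b2 * e1 * e1 - c1 * f2 * f2 = 1).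
  { transitivity ((s * v - t * u) ^ 2 *
      (a * b * c + 2 * d * e * f - a * d * d - b * e * e - c * f * f)).
    - unfold d2, b2, f2, b1, f1, c1, e1, d1. ring.
    - rewrite hdet, h1. ring. }
  assert (Ev : ternary a b c d e f x y z = ternary a b2 c1 d2 e1 f2
    (x - k * (v * y - t * z)) (v * y - t * z) (s * z - u * y)).
  { transitivity (ternary a b c d e f x
      (s * (v * y - t * z) + t * (s * z - u * y))
      (u * (v * y - t * z) + v * (s * z - u * y))).
    - replace (s * (v * y - t * z) + t * (s * z - u * y)) with ((s * v - t * u) * y) by ring.
      replace (u * (v * y - t * z) + v * (s * z - u * y)) with ((s * v - t * u) * z) by ring.
      rewrite h1. f_equal; ring.
    - unfold ternary, d2, b2, f2, b1, f1, c1, e1, d1. ring. }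
  rewrite Ev.
  cut (forall x y z, exists X Y Z, ternary a b2 c1 d2 e1 f2 x y z = X * X + Y * Y + Z * Z).
  { intros H. apply H. }
  clear Ev x y z. intros x y z.
  clearbody b2 c1 d2 e1 f2. clear Ep hG h1 hab hdet.
  destruct (Z_lt_le_dec b2 a) as [hb | hb].
  - assert (hb0 : 0 < b2) by nia.
    destruct (IH b2 (conj (Z.lt_le_incl _ _ hb0) hb) hb0 a c1 e1 d2 f2 ltac:(lia) ltac:(lia)
      y x z) as (X & Y & Z & hS).
    exists X, Y, Z. rewrite <- hS. unfold ternary. ring.
  - set (p := a * b2 - f2 * f2) in *.
    assert (4 * (f2 * f2) <= a * a) by nia.
    assert (3 * (a * a) <= 4 * p) by nia.
    assert (a1 : a = 1).
    { assert (9 * (a * a) ^ 2 <= 16 * p ^ 2) by nia.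
      assert (27 * (a * (a * a * a)) <= 64 * a) by nia.
      assert (27 * (a * a * a) <= 64) by nia.
      nia. }
    subst a.
    assert (f0 : f2 = 0) by nia. subst f2.
    assert (b21 : b2 = 1) by (unfold p in *; nia). subst b2.
    exists (x + e1 * z), (y + d2 * z), z.
    unfold ternary.
    replace c1 with (1 + d2 * d2 + e1 * e1) by lia. ring.
Qed.

(** The form with coefficients [2 q w], [c], [n] on the diagonal and [t b], [2 t q], [b w]
    off the diagonal, where [2 q c = w b^2 + 1], has determinant one and takes the value [n]
    at [(0, 0, 1)].  The leading two-by-two minor is [w].  The form is [1 / n] times
    [R^2 + 2 (q x^2 + b x y + h y^2)] with [R = 2 t q x + t b y + n z], whose values are
    divisible by [n]. *)
Lemma three_squares_of_auxiliary (n q t w b h : Z) : 0 < n -> 0 < q ->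
  2 * q * t * t + 1 = n * w -> b * b + n = 4 * q * h ->
  exists X Y Z, n = X * X + Y * Y + Z * Z.
Proof.
  intros hn hq hw hb.
  assert (hd : (2 * q | w * b * b + 1)).
  { apply Gauss with n.
    - exists (t * t * b * b + 2 * h).
      transitivity (n * w * b * b + n); [ring|]. rewrite <- hw.
      replace ((2 * q * t * t + 1) * b * b + n) with (2 * q * t * t * b * b + (b * b + n)) by ring.
      rewrite hb. ring.
    - apply bezout_rel_prime. apply Bezout_intro with (- t * t) w.
      replace (w * n) with (n * w) by ring. rewrite <- hw. ring. }
  destruct hd as [c hc].
  destruct (ternary_unimodular (2 * q * w) c n (t * b) (2 * t * q) (b * w)) with
    (x := 0) (y := 0) (z := 1) as (X & Y & Z & hS).
  - assert (0 < w) by nia. nia.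
  - replace (2 * q * w * c) with (w * (c * (2 * q))) by ring. rewrite <- hc. nia.
  - set (S := 2 * q * t * t) in *.
    transitivity (w * n * (c * (2 * q)) + 2 * S * b * b * w - S * w * b * b
      - (c * (2 * q)) * S - n * b * b * w * w).
    + unfold S. ring.
    + rewrite <- hc. replace S with (n * w - 1) by lia. ring.
  - exists X, Y, Z. rewrite <- hS. unfold ternary. ring.
Qed.

Module ThreeSquares.
Import all_boot all_order all_algebra all_solvable all_field zify ring lra realalg.
Set Implicit Arguments. Unset Strict Implicit. Unset Printing Implicit Defensive.
Import Order.TTheory GRing.Theory Num.Theory.
Local Open Scope ring_scope.

(** * The Legendre symbol and quadratic reciprocity *)

(** Euler's criterion is taken as the definition: multiplicativity is then immediate, and
    the values can be computed in any field of characteristic [p]. *)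
Definition legendre (p : nat) (a : int) : int :=
  let x := a%:~R ^+ (p.-1)./2 : 'F_p in
  if x == 0 then 0 else if x == 1 then 1 else -1.

Lemma odd_prime_half p : prime p -> odd p -> (p.-1 = (p.-1)./2 * 2)%N.
Proof. by move=> /prime_gt0; case: p => // p _ /= /negbTE op; rewrite muln2 -[LHS]odd_double_half op. Qed.

(** An integer vanishes in a field of characteristic [p] exactly when it vanishes in the
    prime field, so the symbol may be evaluated inside an extension that contains roots of
    unity. *)
Lemma legendreE (L : fieldType) p (a : int) : odd p -> p \in [pchar L] ->
  (legendre p a)%:~R = a%:~R ^+ (p.-1)./2 :> L.
Proof.
move=> op pL; have pp := pcharf_prime pL.
have pF := pchar_Fp pp.
suff: ((legendre p a)%:~R = a%:~R ^+ (p.-1)./2 :> 'F_p).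
  move/eqP; rewrite -subr_eq0 -rmorphXn -rmorphB -(dvdz_pcharf pF) (dvdz_pcharf pL).
  by rewrite rmorphB rmorphXn subr_eq0 => /eqP.
rewrite /legendre; set x := _ ^+ _.
have [->|x0] := eqVneq x 0; first by [].
have [->|x1] := eqVneq x 1; first by [].
have: x ^+ 2 == 1.
  rewrite /x -exprM -odd_prime_half //.
  have a0 : a%:~R != 0 :> 'F_p.
    apply: contraNneq x0 => /eqP a0; rewrite /x (eqP a0) expr0n.
    by case: p op pp {x x1 pF pL a0} => [|[|[|]]].
  rewrite -(inj_eq (mulfI a0)) mulr1 -exprS prednK ?prime_gt0 //.
  by rewrite -[X in _ ^+ X](card_Fp pp) expf_card.
by rewrite sqrf_eq1 (negPf x1) /= => /eqP ->.
Qed.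

Lemma legendre_values p a : [\/ legendre p a = 0, legendre p a = 1 | legendre p a = -1].
Proof.
by rewrite /legendre; case: ifP => _; [apply: Or31|case: ifP => _; [apply: Or32|apply: Or33]].
Qed.

Lemma sign_values_inj (L : fieldType) p (x y : int) : odd p -> p \in [pchar L] ->
  [\/ x = 0, x = 1 | x = -1] -> [\/ y = 0, y = 1 | y = -1] ->
  x%:~R = y%:~R :> L -> x = y.
Proof.
move=> op pL vx vy /eqP; rewrite -subr_eq0 -rmorphB -(dvdz_pcharf pL) dvdzE /= => d.
have p2 : (2 < p)%N by move/pcharf_prime/prime_gt1: pL; case: p op {d} => [|[|[|]]].
have [d0|/dvdn_leq /(_ d)] := posnP `|x - y|%N; first by lia.
by case: vx vy => -> [] ->; rewrite /= leqNgt // (leq_trans _ p2).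
Qed.

Lemma legendreM p : prime p -> odd p -> {morph legendre p : a b / a * b}.
Proof.
move=> pp op a b; have pF := pchar_Fp pp.
apply: (sign_values_inj op pF); first exact: legendre_values.
  by case: (legendre_values p a) => ->; case: (legendre_values p b) => ->;
    rewrite ?mul0r ?mulr0 ?mul1r ?mulN1r ?opprK; try exact: Or31; try exact: Or32; exact: Or33.
by rewrite intrM !(legendreE _ op pF) intrM exprMn.
Qed.

Lemma legendre_eqmod p a b : prime p -> (p %| a - b)%Z -> legendre p a = legendre p b.
Proof.
move=> pp; rewrite (dvdz_pcharf (pchar_Fp pp)) rmorphB subr_eq0 => /eqP e.
by rewrite /legendre e.
Qed.

Lemma legendre_eq0 p a : prime p -> odd p -> (legendre p a == 0) = (p %| a)%Z.
Proof.
move=> pp op; have pF := pchar_Fp pp.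
rewrite (dvdz_pcharf pF).
have h : (0 < (p.-1)./2)%N by case: p op pp {pF} => [|[|[|]]].
transitivity ((legendre p a)%:~R == 0 :> 'F_p).
  by case: (legendre_values p a) => ->; rewrite ?rmorphN ?rmorph1 ?oppr_eq0 ?oner_eq0 ?eqxx.
by rewrite (legendreE _ op pF) expf_eq0 h.
Qed.

Lemma legendre1 p : prime p -> odd p -> legendre p 1 = 1.
Proof.
by move=> pp op; rewrite /legendre rmorph1 expr1n oner_eq0 eqxx.
Qed.

Lemma finField_prim_root (F : finFieldType) : exists z : F, #|F|.-1.-primitive_root z.
Proof.
have c1 : (1 < #|F|)%N := finNzRing_gt1 F.
have u : all #|F|.-1.-unity_root (enum (predC1 (0 : F))).
  apply/allP => x; rewrite mem_enum inE => x0.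
  rewrite unity_rootE -(inj_eq (mulfI x0)) mulr1 -exprS prednK; last exact: ltnW.
  by rewrite expf_card.
have /hasP [z _ pz] : has #|F|.-1.-primitive_root (enum (predC1 (0 : F))).
  by apply: has_prim_root; rewrite ?enum_uniq -?cardE ?cardC1 // -ltnS prednK // ltnW.
by exists z.
Qed.

(** The field with [p ^ totient m] elements works, since [m] divides the order of its
    cyclic group of units. *)
Lemma exists_prim_root p m : prime p -> coprime p m -> (0 < m)%N ->
  exists (L : fieldType) (z : L), p \in [pchar L] /\ m.-primitive_root z.
Proof.
move=> pp cpm m0.
have t0 : (0 < totient m)%N by rewrite totient_gt0.
have [F pF cF] := pPrimePowerField pp t0.
have [z] := finField_prim_root F.
rewrite cF => pz; exists F, (z ^+ ((p ^ totient m).-1 %/ m)); split=> //.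
apply: (dvdn_prim_root pz).
rewrite -subn1 -eqn_mod_dvd ?expn_gt0 ?prime_gt0 //.
by apply/eqP; apply: Euler_exp_totient.
Qed.

Lemma legendre_eq1_square p a : prime p -> odd p -> legendre p a = 1 ->
  exists t : nat, (p %| t%:Z ^+ 2 - a)%Z.
Proof.
move=> pp op; have pF := pchar_Fp pp.
move/(congr1 (fun z : int => z%:~R : 'F_p)); rewrite (legendreE _ op pF) rmorph1 => h.
have [z] := finField_prim_root 'F_p; rewrite card_Fp // => pz.
have h2 : a%:~R ^+ p.-1 = 1 :> 'F_p by rewrite (odd_prime_half pp op) exprM h expr1n.
have [[i ip] /= Ei] := prim_rootP pz h2.
have h0 : (0 < (p.-1)./2)%N by case: p op pp {pF h z pz h2 ip i Ei} => [|[|[|]]].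
move: h; rewrite Ei -exprM => /eqP; rewrite -(prim_order_dvd pz).
rewrite {1}(odd_prime_half pp op) mulnC dvdn_pmul2r // => /dvdnP [j Ej].
exists (z ^+ j : 'F_p); rewrite (dvdz_pcharf pF) rmorphB rmorphXn /= Ei Ej exprM.
by rewrite -[(_ : nat)%:~R]/(_%:R) natr_Zp subrr.
Qed.

Lemma exists_nonresidue p : prime p -> odd p -> exists g : nat, legendre p g%:Z = -1.
Proof.
move=> pp op; have pF := pchar_Fp pp.
have [z] := finField_prim_root 'F_p; rewrite card_Fp // => pz.
have h0 : (0 < (p.-1)./2)%N by case: p op pp {pF z pz} => [|[|[|]]].
have zE : (z : nat)%:~R = z :> 'F_p by rewrite -[(_ : nat)%:~R]/(_%:R) natr_Zp.
have z1 : z ^+ (p.-1)./2 != 1.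
  rewrite -(prim_order_dvd pz) {1}(odd_prime_half pp op); apply/negP => /dvdn_leq.
  by move/(_ h0); rewrite muln2 -addnn -{3}[(p.-1)./2]addn0 leq_add2l leqNgt h0.
exists z; rewrite /legendre zE (negPf z1) expf_eq0 h0 /=.
case: eqP => // z0; have := prim_expr_order pz; rewrite z0 expr0n.
have -> : (p.-1 == 0)%N = false by apply/negbTE; rewrite (odd_prime_half pp op) muln2 double_eq0 -lt0n.
by move/esym/eqP; rewrite oner_eq0.
Qed.

Lemma sum_periodic_mul (V : nmodType) (F : nat -> V) n c : (0 < n)%N -> coprime c n ->
  (forall a, F (a %% n)%N = F a) ->
  \sum_(0 <= a < n) F (c * a)%N = \sum_(0 <= a < n) F a.
Proof.
move=> n0 cn pF; rewrite !big_mkord.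
pose h (i : 'I_n) := Ordinal (ltn_pmod (c * i) n0).
rewrite [RHS](reindex_inj (h := h)).
  by apply: eq_bigr => i _ /=; rewrite pF.
move=> i j [] /eqP.
wlog le : i j / (i <= j)%N.
  by move=> H; case/orP: (leq_total i j) => l e; [|apply/esym]; apply: H => //; rewrite eq_sym.
rewrite eq_sym eqn_mod_dvd ?leq_mul2l ?le ?orbT // -mulnBr Gauss_dvdr; last by rewrite coprime_sym.
move=> d; apply/val_inj/eqP; rewrite /= eqn_leq le -subn_eq0 /=.
case: (posnP (j - i)) => [//|gt]; have := dvdn_leq gt d.
by rewrite leqNgt (leq_ltn_trans (leq_subr _ _)).
Qed.

(** Multiplication by [g] permutes the residues and changes the sign of the sum. *)
Lemma sum_periodic_character (F : nat -> int) n g : (0 < n)%N -> coprime g n ->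
  (forall a, F (a %% n)%N = F a) -> {morph F : a b / (a * b)%N >-> a * b} -> F g = -1 ->
  \sum_(0 <= a < n) F a = 0.
Proof.
move=> n0 cg pF mF Fg.
have := sum_periodic_mul n0 cg pF.
under eq_bigr do rewrite mF Fg.
rewrite -mulr_sumr mulN1r; move: (\sum_(_ <= _ < _) _) => S; lia.
Qed.

(* Unfolding the symbol would make unification compute in prime fields. *)
#[global] Opaque legendre.

Section GaussSum.
Variables (l : nat) (L : fieldType) (z : L).
Hypotheses (pl : prime l) (ol : odd l).
Hypothesis pz : l.-primitive_root z.

Local Notation chi a := ((legendre l a%:Z)%:~R : L).

Let chi_mod a : chi (a %% l)%N = chi a.
Proof.
congr (_%:~R); apply: legendre_eqmod => //.
by apply/dvdzP; exists (- (a %/ l)%N%:Z); lia.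
Qed.

Let chiM a b : chi (a * b)%N = chi a * chi b.
Proof. by rewrite PoszM legendreM // rmorphM. Qed.

Let z_mod a : z ^+ (a %% l) = z ^+ a.
Proof. exact: prim_expr_mod. Qed.

Let chi0 a : (l %| a)%N -> chi a = 0.
Proof.
move=> la; suff -> : legendre l a%:Z = 0 by [].
by apply/eqP; rewrite legendre_eq0.
Qed.

Let chi_sqr a : ~~ (l %| a)%N -> chi a * chi a = 1.
Proof.
move=> la; rewrite -rmorphM.
suff -> : legendre l a%:Z * legendre l a%:Z = 1 by [].
have: legendre l a%:Z != 0 by rewrite legendre_eq0.
by case: (legendre_values l a%:Z) => ->.
Qed.

Let chi_sum : \sum_(0 <= a < l) chi a = 0.
Proof.
have [g Eg] := exists_nonresidue pl ol.
rewrite -[LHS](rmorph_sum (intmul (1 : L))) /=.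
rewrite (@sum_periodic_character (fun a => legendre l a%:Z) l g) ?prime_gt0 //.
- rewrite coprime_sym prime_coprime //; apply/negP => d.
  by have := legendre_eq0 g pl ol; rewrite Eg dvdzE /= d.
- move=> a; apply: legendre_eqmod => //; apply/dvdzP; exists (- (a %/ l)%N%:Z); lia.
- by move=> a b; rewrite PoszM legendreM.
Qed.

(** For [c] prime to [l] substitute [a -> c * a]; for [c] divisible by [l] both sides vanish
    because the character sums to zero. *)
Lemma gauss_sum_twist c :
  \sum_(0 <= a < l) chi a * z ^+ (c * a) = chi c * \sum_(0 <= a < l) chi a * z ^+ a.
Proof.
have [lc|lc] := boolP (l %| c)%N.
  rewrite chi0 // mul0r -[RHS]chi_sum; apply: eq_bigr => a _.
  suff -> : z ^+ (c * a) = 1 by rewrite mulr1.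
  by apply/eqP; rewrite -(prim_order_dvd pz) dvdn_mulr.
have cl : coprime c l by rewrite coprime_sym prime_coprime.
rewrite -(sum_periodic_mul (F := fun a => chi a * z ^+ a) (prime_gt0 pl) cl); last first.
  by move=> a; rewrite chi_mod z_mod.
rewrite mulr_sumr; apply: eq_bigr => a _.
by rewrite chiM mulrA mulrA chi_sqr // mul1r.
Qed.

Let geometric d : \sum_(0 <= b < l) z ^+ (b * d) = if (l %| d)%N then l%:R else 0.
Proof.
have [ld|ld] := boolP (l %| d)%N.
  transitivity (\sum_(0 <= b < l) (1 : L)); last by rewrite sumr_const_nat subn0.
  apply: eq_bigr => b _.
  by apply/eqP; rewrite -(prim_order_dvd pz) dvdn_mull.
have z1 : z ^+ d - 1 != 0 by rewrite subr_eq0 -(prim_order_dvd pz).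
apply: (mulfI z1); rewrite mulr0 big_mkord.
under eq_bigr do rewrite mulnC exprM.
by rewrite -subrX1 exprAC (prim_expr_order pz) expr1n subrr.
Qed.

(** Twisting each summand of one factor by the index of the other leaves geometric sums
    over [b] of [z ^ (b * (1 + a))], which vanish unless [a = -1] modulo [l]. *)
Lemma gauss_sum_sqr :
  (\sum_(0 <= a < l) chi a * z ^+ a) ^+ 2 = (legendre l (-1) * l%:Z)%:~R.
Proof.
set tau := \sum_(0 <= a < l) _.
rewrite expr2 {1}/tau mulr_suml.
under eq_bigr => b _.
  rewrite mulrAC -gauss_sum_twist mulr_suml.
  under eq_bigr => a _ do rewrite -mulrA -exprD addnC -mulnS.
  over.
rewrite exchange_big /=.
under eq_bigr => a _ do rewrite -mulr_sumr geometric.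
have [m Em] : exists m, l = m.+1 by exists l.-1; rewrite prednK ?prime_gt0.
rewrite {1}Em big_nat_recr //= big_nat big1 ?add0r => [|a /andP [_ am]]; last first.
  by rewrite ifN ?mulr0 // Em; apply/negP => d; have := dvdn_leq (ltn0Sn a) d; rewrite ltnS leqNgt am.
rewrite -Em dvdnn intrM; congr (_%:~R * _).
by apply: legendre_eqmod => //; apply/dvdzP; exists 1; lia.
Qed.

Lemma gauss_sum_frobenius p : p \in [pchar L] ->
  (\sum_(0 <= a < l) chi a * z ^+ a) ^+ p =
  chi p * \sum_(0 <= a < l) chi a * z ^+ a.
Proof.
move=> pL; rewrite -(pFrobenius_autE pL) rmorph_sum /= -gauss_sum_twist.
apply: eq_bigr => a _; rewrite rmorphM /= rmorph_int !pFrobenius_autE.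
by rewrite -exprM mulnC.
Qed.

End GaussSum.

(** If [s] is a square root of [c] in an extension, then [c ^ ((p - 1) / 2) = s ^ p / s], so
    the symbol of [c] records whether Frobenius fixes [s] or changes its sign. *)
Lemma legendre_of_square_root (L : fieldType) p (c e : int) (s : L) :
  odd p -> p \in [pchar L] -> s ^+ 2 = c%:~R -> s != 0 -> e = 1 \/ e = -1 ->
  s ^+ p = e%:~R * s -> legendre p c = e.
Proof.
move=> op pL sc s0 he sp; have pp := pcharf_prime pL.
apply: (sign_values_inj op pL); [exact: legendre_values|by case: he; [apply: Or32|apply: Or33]|].
rewrite (legendreE _ op pL) -sc -exprM mulnC -odd_prime_half //.
by apply: (mulIf s0); rewrite -exprSr prednK ?prime_gt0.
Qed.

(** The Gauss sum is a square root of [(-1 / l) * l], and Frobenius multiplies it by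
    [(p / l)]. *)
Lemma legendre_reciprocity l p : prime l -> odd l -> prime p -> odd p -> l != p ->
  legendre p (legendre l (-1) * l%:Z) = legendre l p%:Z.
Proof.
move=> pl ol pp op lp.
have cpl : coprime p l by rewrite prime_coprime // dvdn_prime2 // eq_sym.
have [L [z [pL pz]]] := exists_prim_root pp cpl (prime_gt0 pl).
have s2 := gauss_sum_sqr pl ol pz.
apply: (legendre_of_square_root op pL s2); last exact: gauss_sum_frobenius.
  apply/eqP => s0; move: s2; rewrite s0 expr0n /= => /esym/eqP.
  rewrite -(dvdz_pcharf pL) dvdzE abszM Gauss_dvdr; last first.
    have: legendre l (-1) != 0 by rewrite legendre_eq0 // dvdzE dvdn1; have := prime_gt1 pl; lia.
    by case: (legendre_values l (-1)) => -> /= => [|_|_]; rewrite ?eqxx ?coprimen1.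
  by rewrite /= dvdn_prime2 // eq_sym (negPf lp).
have: legendre l p%:Z != 0 by rewrite legendre_eq0 // dvdzE /= dvdn_prime2.
by case: (legendre_values l p%:Z) => -> // _; [left|right].
Qed.

Definition sign_mod4 (m : nat) : int := if (m %% 4 == 1)%N then 1 else -1.
Definition sign_mod8 (m : nat) : int := if (m %% 8 \in [:: 1; 7])%N then 1 else -1.

Lemma legendre_minus1 p : prime p -> odd p -> legendre p (-1) = sign_mod4 p.
Proof.
move=> pp op; have pF := pchar_Fp pp.
apply: (sign_values_inj op pF); first exact: legendre_values.
  by rewrite /sign_mod4; case: ifP => _; [apply: Or32|apply: Or33].
rewrite (legendreE _ op pF) rmorphN1 -signr_odd /sign_mod4.
have -> : odd (p.-1)./2 = ~~ (p %% 4 == 1)%N by have := odd_prime_half pp op; lia.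
by case: eqP => _; rewrite ?expr0 ?expr1 ?rmorph1 ?rmorphN1.
Qed.

(** With [z] a primitive eighth root of unity, [z + 1 / z] is a square root of [2], and
    Frobenius sends it to [z ^ p + z ^ (- p)]. *)
Lemma legendre_2 p : prime p -> odd p -> legendre p 2 = sign_mod8 p.
Proof.
move=> pp op.
have c8 : coprime p 8 by rewrite (coprime_pexpr p 2 (isT : (0 < 3)%N)) coprimen2.
have [L [z [pL pz]]] := exists_prim_root pp c8 isT.
have z0 : z != 0.
  by apply/eqP => z0; move/eqP: (prim_expr_order pz); rewrite z0 expr0n /= eq_sym oner_eq0.
have z4 : z ^+ 4 = -1.
  have: (z ^+ 4) ^+ 2 == 1 by rewrite -exprM prim_expr_order.
  by rewrite sqrf_eq1 -(prim_order_dvd pz) /= => /eqP.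
have s2 : (z + z^-1) ^+ 2 = 2%:~R.
  have -> : (z + z^-1) ^+ 2 = (z ^+ 4 + 1) * z ^- 2 + 2 by field.
  by rewrite z4 addNr mul0r add0r.
have n2 : (2 : L) != 0.
  rewrite -(dvdn_pcharf pL); apply/negP; rewrite dvdn_prime2 // => /eqP p2.
  by rewrite p2 in op.
apply: (legendre_of_square_root op pL s2).
- by apply/eqP => s0; move/eqP: s2; rewrite s0 expr0n /= eq_sym; apply/negP.
- by rewrite /sign_mod8; case: ifP; [left|right].
rewrite -(pFrobenius_autE pL) rmorphD /= !pFrobenius_autE exprVn -(prim_expr_mod pz p).
have : (p %% 8 \in [:: 1; 3; 5; 7])%N by rewrite !inE; lia.
have z5 : z ^+ 5 = - z by rewrite exprS z4 mulrN1.
have z3 : z ^+ 3 = - z^-1 by apply: (mulIf z0); rewrite -exprSr z4 mulNr mulVf.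
have z7 : z ^+ 7 = z^-1 by apply: (mulIf z0); rewrite -exprSr (prim_expr_order pz) mulVf.
rewrite /sign_mod8 !inE; case/or4P => /eqP -> /=;
  rewrite ?expr1 ?z3 ?z5 ?z7 ?rmorph1 ?rmorphN1 ?mul1r ?mulN1r ?invrN ?invrK ?opprD //; exact: addrC.
Qed.

Lemma sign_mod4M a b : odd a -> odd b -> sign_mod4 (a * b) = sign_mod4 a * sign_mod4 b.
Proof.
move=> oa ob; rewrite /sign_mod4 -modnMm.
have : (a %% 4 \in [:: 1; 3])%N by rewrite !inE; lia.
have : (b %% 4 \in [:: 1; 3])%N by rewrite !inE; lia.
by rewrite !inE; do 2!case/orP => /eqP ->.
Qed.

Lemma sign_mod8M a b : odd a -> odd b -> sign_mod8 (a * b) = sign_mod8 a * sign_mod8 b.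
Proof.
move=> oa ob; rewrite /sign_mod8 -modnMm.
have : (a %% 8 \in [:: 1; 3; 5; 7])%N by rewrite !inE; lia.
have : (b %% 8 \in [:: 1; 3; 5; 7])%N by rewrite !inE; lia.
by rewrite !inE; do 2!case/or4P => /eqP ->.
Qed.

Lemma prod_odd (s : seq nat) : all odd s -> odd (\prod_(p <- s) p)%N.
Proof. by elim: s => [|p s IH] /=; rewrite ?big_nil ?big_cons ?oddM // => /andP [-> /IH]. Qed.

Lemma prod_legendre_sign (s : seq nat) (c : int) (sg : nat -> int) :
  sg 1%N = 1 -> (forall a b, odd a -> odd b -> sg (a * b)%N = sg a * sg b) ->
  (forall p, prime p -> odd p -> legendre p c = sg p) ->
  all prime s -> all odd s ->
  \prod_(p <- s) legendre p c = sg (\prod_(p <- s) p)%N.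
Proof.
move=> sg1 sgM sgp; elim: s => [|p s IH] /=; first by rewrite !big_nil.
case/andP => pp ps /andP [op os].
by rewrite !big_cons sgM ?prod_odd // sgp // IH.
Qed.

(** * Divisor sums and the hyperbola method *)

(** Divisors of [q] as factorisations [q = e * f], with the ranges of both factors made
    independent of [q] so that sums can be exchanged. *)
Lemma divisor_sum_pairs (V : nmodType) (G : nat -> nat -> V) q N : (0 < q <= N)%N ->
  \sum_(d <- divisors q) G d (q %/ d)%N =
  \sum_(1 <= e < N.+1) \sum_(1 <= f < N.+1 | (e * f == q)%N) G e f.
Proof.
case/andP => q0 qN.
transitivity (\sum_(1 <= e < N.+1 | (e %| q)%N) G e (q %/ e)%N).
  rewrite -[RHS]big_filter; apply: perm_big; apply: uniq_perm.
  - exact: divisors_uniq.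
  - by rewrite filter_uniq ?iota_uniq.
  move=> d; rewrite -dvdn_divisors // mem_filter mem_index_iota.
  case dq: (d %| q)%N => //=; rewrite (dvdn_gt0 q0 dq) ltnS.
  by rewrite (leq_trans (dvdn_leq q0 dq)).
rewrite big_mkcond /= big_nat [RHS]big_nat; apply: eq_bigr => e /andP [e0 eN].
case: ifPn => [/dvdnP [f Ef]|ne]; last first.
  by rewrite big1 // => f /eqP E; case/negP: ne; rewrite -E dvdn_mulr.
have Hf : (q %/ e)%N = f by rewrite Ef mulnK.
rewrite Hf -big_filter (_ : [seq _ <- _ | _] = [:: f]) ?big_seq1 //.
rewrite (eq_filter (a2 := pred1 f)); last first.
  by move=> k /=; rewrite Ef mulnC eqn_pmul2r.
apply: filter_pred1_uniq; first exact: iota_uniq.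
rewrite mem_index_iota; nia.
Qed.

Lemma divisor_sum_exchange (R : comPzRingType) (w : nat -> R) (G : nat -> nat -> R) N :
  \sum_(1 <= q < N.+1) w q * (\sum_(d <- divisors q) G d (q %/ d)%N) =
  \sum_(1 <= e < N.+1) \sum_(1 <= f < N.+1 | (e * f <= N)%N) w (e * f)%N * G e f.
Proof.
transitivity (\sum_(1 <= q < N.+1) \sum_(1 <= e < N.+1) \sum_(1 <= f < N.+1)
   (if (e * f == q)%N then w (e * f)%N * G e f else 0)).
  rewrite big_nat [RHS]big_nat; apply: eq_bigr => q qN.
  rewrite (@divisor_sum_pairs _ G q N) // mulr_sumr; apply: eq_bigr => e _.
  rewrite mulr_sumr -big_mkcond /=; apply: eq_bigr => f /eqP -> //.
rewrite exchange_big /= big_nat [RHS]big_nat; apply: eq_bigr => e /andP [e0 eN].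
rewrite exchange_big /= [RHS]big_mkcond /= big_nat [RHS]big_nat.
apply: eq_bigr => f /andP [f0 fN].
rewrite -big_mkcond /= -big_filter.
rewrite (eq_filter (a2 := pred1 (e * f)%N)); last by move=> k; rewrite /= eq_sym.
case: ifPn => h.
  rewrite filter_pred1_uniq ?iota_uniq ?big_seq1 //.
  rewrite mem_index_iota; nia.
rewrite (eq_in_filter (a2 := pred0)) ?filter_pred0 ?big_nil // => k.
rewrite mem_index_iota /= => hk; apply/negbTE/eqP => E; case/negP: h; lia.
Qed.

Lemma divisor_sum_swap (R : comPzRingType) (w a b : nat -> R) N :
  \sum_(1 <= q < N.+1) w q * (\sum_(d <- divisors q) a d * b (q %/ d)%N) =
  \sum_(1 <= q < N.+1) w q * (\sum_(d <- divisors q) b d * a (q %/ d)%N).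
Proof.
rewrite (divisor_sum_exchange w (fun d f => a d * b f)).
rewrite (divisor_sum_exchange w (fun d f => b d * a f)).
rewrite (exchange_big_dep_nat xpredT) //=.
apply: eq_bigr => f _; apply: eq_big => [e|e _]; first by rewrite mulnC.
by rewrite mulnC [X in _ * X]mulrC.
Qed.

Section Abel.
Variables (R : realDomainType) (a w : nat -> R) (M : R) (u : nat).
Hypothesis w0 : forall i, 0 <= w i.
Hypothesis wle : forall i, (u <= i)%N -> w i.+1 <= w i.
Hypothesis bound : forall v, `|\sum_(u <= i < v) a i| <= M.

(** Summation by parts: the weights decrease, so their total variation is at most [w u]. *)
Lemma abel_bound v : `|\sum_(u <= i < v) a i * w i| <= M * w u.
Proof.
have M0 : 0 <= M by apply: le_trans (bound 0); apply: normr_ge0.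
have [vu|/ltnW uv] := leqP v u; first by rewrite big_geq // normr0 mulr_ge0.
rewrite -(subnKC uv); elim: {v uv}(v - u)%N => [|k _]; first by rewrite addn0 big_geq // normr0 mulr_ge0.
have E j : \sum_(u <= i < u + j) a i * w i = (\sum_(u <= i < u + j) a i) * w (u + j)%N
  + \sum_(u <= i < u + j) (\sum_(u <= l < i.+1) a l) * (w i - w i.+1).
  elim: j => [|j IH]; first by rewrite addn0 !big_geq // mul0r addr0.
  by rewrite addnS !big_nat_recr ?leq_addr //= IH; ring.
rewrite E; apply: le_trans (ler_normD _ _) _.
have -> : M * w u = M * w (u + k.+1)%N + M * (w u - w (u + k.+1)%N) by ring.
apply: lerD; first by rewrite normrM (ger0_norm (w0 _)) ler_wpM2r.
apply: le_trans (ler_norm_sum _ _ _) _.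
have -> : M * (w u - w (u + k.+1)%N) = \sum_(u <= i < u + k.+1) M * (w i - w i.+1).
  rewrite -mulr_sumr; congr (_ * _); elim: k.+1 => [|j IH]; first by rewrite addn0 subrr big_geq.
  by rewrite addnS big_nat_recr ?leq_addr //= -IH; ring.
rewrite big_nat [leRHS]big_nat; apply: ler_sum => i /andP [ui _].
by rewrite normrM (ger0_norm (x := w i - _)) ?subr_ge0 ?wle // ler_wpM2r ?subr_ge0 ?wle.
Qed.
End Abel.

Section Hyperbola.
Variables (R : rcfType).

Definition inv_sqrt (k : nat) : R := (Num.sqrt k%:R)^-1.

Lemma inv_sqrt_ge0 k : 0 <= inv_sqrt k.
Proof. by rewrite invr_ge0 sqrtr_ge0. Qed.

Lemma inv_sqrtM a b : inv_sqrt (a * b) = inv_sqrt a * inv_sqrt b.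
Proof. by rewrite /inv_sqrt natrM sqrtrM // invfM. Qed.

Lemma inv_sqrt_le i j : (0 < i <= j)%N -> inv_sqrt j <= inv_sqrt i.
Proof.
case/andP => i0 ij; rewrite /inv_sqrt lef_pV2 ?posrE ?sqrtr_gt0 ?ltr0n ?(leq_trans i0) //.
by rewrite ler_sqrt ?ler0n // ler_nat.
Qed.

Lemma sum_inv_sqrt y : \sum_(1 <= i < y.+1) inv_sqrt i <= 2 * Num.sqrt y%:R.
Proof.
elim: y => [|y IH]; first by rewrite big_geq // mulr_ge0 ?sqrtr_ge0.
rewrite big_nat_recr //=; apply: le_trans (lerD IH (lexx _)) _.
have s0 : 0 < Num.sqrt (y.+1%:R : R) by rewrite sqrtr_gt0 ltr0n.
have t0 : 0 <= Num.sqrt (y%:R : R) := sqrtr_ge0 _.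
have E : Num.sqrt (y.+1%:R : R) ^+ 2 = Num.sqrt (y%:R : R) ^+ 2 + 1.
  by rewrite !sqr_sqrtr ?ler0n // -natr1.
rewrite /inv_sqrt -(ler_pM2r s0) mulrDl mulVf ?gt_eqF //.
by move: E; set s := Num.sqrt _ in s0 *; set t := Num.sqrt _ in t0 *; nra.
Qed.

Variables (a b : nat -> R) (M : R).
Hypotheses (a1 : forall i, `|a i| <= 1) (b1 : forall i, `|b i| <= 1).
Hypothesis aM : forall u v, `|\sum_(u <= i < v) a i| <= M.
Hypothesis bM : forall u v, `|\sum_(u <= i < v) b i| <= M.

Let aw := fun i => a i * inv_sqrt i.
Let bw := fun i => b i * inv_sqrt i.

Let M0 : 0 <= M.
Proof. by apply: le_trans (aM 0 0); apply: normr_ge0. Qed.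

(** One of the two arms of the hyperbola: for each [e <= y] the long sum over [f > y] is
    [O(M / sqrt y)], and there are weights [1 / sqrt e] adding up to [2 * sqrt y]. *)
Let arm_bound (c d : nat -> R) y : (0 < y)%N -> (forall i, `|c i| <= 1) ->
  (forall u v, `|\sum_(u <= i < v) d i| <= M) ->
  `|\sum_(1 <= e < y.+1) \sum_(y.+1 <= f < (y ^ 2).+1 | (e * f <= y ^ 2)%N)
     (c e * inv_sqrt e) * (d f * inv_sqrt f)| <= 2 * M.
Proof.
move=> y0 c1 dM; apply: le_trans (ler_norm_sum _ _ _) _.
have s0 : 0 < Num.sqrt (y%:R : R) by rewrite sqrtr_gt0 ltr0n.
apply: (@le_trans _ _ (\sum_(1 <= e < y.+1) inv_sqrt e * (M * inv_sqrt y))); last first.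
  rewrite -mulr_suml; apply: le_trans (ler_wpM2r _ (sum_inv_sqrt y)) _.
    by rewrite mulr_ge0 ?inv_sqrt_ge0.
  by rewrite /inv_sqrt mulrACA divff ?gt_eqF // mulr1.
rewrite big_nat [leRHS]big_nat; apply: ler_sum => e /andP [e0 ey].
rewrite -mulr_sumr normrM normrM (ger0_norm (inv_sqrt_ge0 e)) ler_pM ?mulr_ge0 ?inv_sqrt_ge0 //.
  by rewrite -[leRHS]mul1r ler_wpM2r ?inv_sqrt_ge0.
have -> : \sum_(y.+1 <= f < (y ^ 2).+1 | (e * f <= y ^ 2)%N) d f * inv_sqrt f =
   \sum_(y.+1 <= f < (y ^ 2 %/ e).+1) d f * inv_sqrt f.
  rewrite [RHS](big_nat_widen _ _ (y ^ 2).+1) ?ltnS ?leq_div //.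
  by apply: eq_bigl => f; rewrite ltnS leq_divRL // mulnC.
apply: le_trans (abel_bound _ _ (dM y.+1) _) _ => //.
- exact: inv_sqrt_ge0.
- by move=> i yi; apply: inv_sqrt_le; rewrite leqnSn (leq_trans _ yi).
by rewrite ler_wpM2l // inv_sqrt_le // y0 leqnSn.
Qed.

(** Dirichlet's hyperbola method with the weight [q ^ (- 1/2)]: the square [e, f <= y]
    factors, and each arm is bounded.  The exponent [1/2] is the one for which the bound
    does not depend on [y]. *)
Lemma hyperbola_bound y : (0 < y)%N ->
  `|\sum_(1 <= q < (y ^ 2).+1) inv_sqrt q * \sum_(d <- divisors q) a d * b (q %/ d)%N|
    <= M ^+ 2 + 4 * M.
Proof.
move=> y0.
rewrite (divisor_sum_exchange inv_sqrt (fun d f => a d * b f)).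
have yy : (y.+1 <= (y ^ 2).+1)%N by rewrite ltnS; nia.
rewrite (eq_bigr (fun e => \sum_(1 <= f < (y ^ 2).+1 | (e * f <= y ^ 2)%N) aw e * bw f));
  last by move=> e _; apply: eq_bigr => f _; rewrite inv_sqrtM /aw /bw; ring.
rewrite (big_cat_nat (ltn0Sn y) yy) /=.
have -> : \sum_(1 <= e < y.+1) \sum_(1 <= f < (y ^ 2).+1 | (e * f <= y ^ 2)%N) aw e * bw f
  = (\sum_(1 <= e < y.+1) aw e) * (\sum_(1 <= f < y.+1) bw f) +
    \sum_(1 <= e < y.+1) \sum_(y.+1 <= f < (y ^ 2).+1 | (e * f <= y ^ 2)%N) aw e * bw f.
  rewrite big_distrlr /= -big_split /= big_nat [RHS]big_nat; apply: eq_bigr => e /andP [e0 ey].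
  rewrite (big_cat_nat (ltn0Sn y) yy) /=; congr (_ + _).
  rewrite big_nat_cond [RHS]big_nat_cond; apply: eq_bigl => f.
  by case fy: (1 <= f < y.+1)%N => //=; nia.
have -> : \sum_(y.+1 <= e < (y ^ 2).+1) \sum_(1 <= f < (y ^ 2).+1 | (e * f <= y ^ 2)%N) aw e * bw f
  = \sum_(1 <= f < y.+1) \sum_(y.+1 <= e < (y ^ 2).+1 | (f * e <= y ^ 2)%N) bw f * aw e.
  transitivity (\sum_(y.+1 <= e < (y ^ 2).+1) \sum_(1 <= f < y.+1)
     (if (f * e <= y ^ 2)%N then bw f * aw e else 0)).
    rewrite big_nat [RHS]big_nat; apply: eq_bigr => e /andP [e0 ey].
    rewrite (big_cat_nat (ltn0Sn y) yy) /= [X in _ + X]big_nat_cond [X in _ + X]big1 ?addr0.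
      by rewrite big_mkcond /=; apply: eq_bigr => f _; rewrite mulnC mulrC.
    move=> f /andP[/andP[f0 fy]] h; exfalso; move: h e0 f0; clear; nia.
  by rewrite exchange_big /=; apply: eq_bigr => f _; rewrite -big_mkcond.
have i1 : inv_sqrt 1 = 1 by rewrite /inv_sqrt sqrtr1 invr1.
have h c : (forall u v, `|\sum_(u <= i < v) c i| <= M) -> `|\sum_(1 <= e < y.+1) c e * inv_sqrt e| <= M.
  move=> cM; rewrite -[M]mulr1 -i1; apply: abel_bound => //; first exact: inv_sqrt_ge0.
  by move=> i i0; apply: inv_sqrt_le; rewrite i0 leqnSn.
have := arm_bound y0 a1 bM; have := arm_bound y0 b1 aM.
have := h a aM; have := h b bM.
rewrite -/aw -/bw; set A := \sum_(1 <= e < y.+1) aw e; set B := \sum_(1 <= e < y.+1) bw e.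
set X := (X in `|X| <= 2 * M -> _); set Y := (X in `|X| <= 2 * M -> _ <= _).
move=> hB hA hX hY.
apply: le_trans (ler_normD _ _) _; apply: le_trans (lerD (ler_normD _ _) (lexx _)) _.
have hAB : `|A * B| <= M ^+ 2 by rewrite normrM expr2 ler_pM.
lra.
Qed.
End Hyperbola.

(** * Squarefree parts and divisor sums of quadratic characters *)

Lemma square_times_primes n : (0 < n)%N ->
  exists f, n = (f ^ 2 * \prod_(p <- [seq p <- primes n | odd (logn p n)]) p)%N.
Proof.
move=> n0; exists (\prod_(p <- primes n) p ^ (logn p n)./2)%N.
rewrite big_filter [X in (_ * X)%N]big_mkcond /=.
rewrite {1}(prod_prime_decomp n0) prime_decompE big_map /=.
rewrite expnS expn1 -!big_split /=; apply: eq_bigr => p _.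
rewrite -{1}(odd_double_half (logn p n)) expnD -addnn expnD mulnC.
by case: odd; rewrite ?expn0 ?expn1.
Qed.

Lemma chinese_primes (s : seq nat) (r : nat -> nat) : uniq s -> all prime s ->
  exists x, forall p, p \in s -> x = r p %[mod p].
Proof.
elim: s => [|p s IH] /=; first by exists 0%N.
case/andP => ps us /andP [pp pps].
have [x Hx] := IH us pps.
have cop : coprime p (\prod_(l <- s) l)%N.
  rewrite big_seq; apply: (big_ind (fun m => coprime p m)); first exact: coprimen1.
    by move=> a b ca cb; rewrite coprimeMr ca.
  move=> l ls; rewrite prime_coprime // dvdn_prime2 ?(allP pps _ ls) //.
  by apply: contraNneq ps => ->.
pose c := chinese p (\prod_(l <- s) l)%N (r p) x.
exists c => l; rewrite /c {c}; rewrite inE => /predU1P [->|ls].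
  exact: chinese_modl.
have ld : (l %| \prod_(l <- s) l)%N by rewrite (big_rem l ls) /= dvdn_mulr.
by rewrite -(Hx l ls) -[LHS](modn_dvdm _ ld) chinese_modr // modn_dvdm.
Qed.

Lemma prod_primes_dvd (s : seq nat) m : uniq s -> all prime s ->
  (forall p, p \in s -> p %| m)%N -> (\prod_(p <- s) p %| m)%N.
Proof.
elim: s => [|p s IH] /=; first by rewrite big_nil dvd1n.
case/andP => ps us /andP [pp pps] H; rewrite big_cons Gauss_dvd.
  by rewrite H ?mem_head // IH // => l ls; rewrite H // inE ls orbT.
rewrite big_seq; apply: (big_ind (fun m => coprime p m)); first exact: coprimen1.
  by move=> a b ca cb; rewrite coprimeMr ca.
move=> l ls; rewrite prime_coprime // dvdn_prime2 ?(allP pps _ ls) //.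
by apply: contraNneq ps => ->.
Qed.

Section CharacterDivisorSum.
Variable chi : nat -> int.
Hypothesis chi1 : chi 1 = 1.
Hypothesis chiM : {morph chi : a b / (a * b)%N >-> a * b}.

Lemma divisor_sum_prime_power p k m : prime p -> ~~ (p %| m)%N -> (0 < m)%N ->
  \sum_(d <- divisors (p ^ k * m)) chi d =
  (\sum_(0 <= i < k.+1) chi p ^+ i) * \sum_(d <- divisors m) chi d.
Proof.
move=> pp pm m0.
have p0 := prime_gt0 pp.
have chiX i : chi (p ^ i) = chi p ^+ i.
  by elim: i => [|i IH]; rewrite ?expn0 ?chi1 ?expr0 // expnS chiM IH exprS.
transitivity (\sum_(d <- [seq (p ^ i * d)%N | i <- index_iota 0 k.+1, d <- divisors m]) chi d); last first.
  rewrite big_allpairs_dep big_distrlr /=; apply: eq_bigr => i _.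
  by apply: eq_bigr => d _; rewrite chiM chiX.
have ndiv d : d \in divisors m -> ~~ (p %| d)%N.
  by rewrite -dvdn_divisors // => dm; apply: contra pm => /dvdn_trans; apply.
have lg i d : d \in divisors m -> logn p (p ^ i * d) = i.
  move=> dm; have d0 : (0 < d)%N by move: dm; rewrite -dvdn_divisors // => /(dvdn_gt0 m0).
  rewrite lognM ?expn_gt0 ?p0 // pfactorK // logn_coprime ?addn0 // prime_coprime //.
  exact: ndiv.
apply: perm_big; apply: uniq_perm; first exact: divisors_uniq.
  apply: allpairs_uniq; rewrite ?iota_uniq ?divisors_uniq //.
  move=> [i d] [j e]; case/allpairsP => -[i1 d1] [_ h1 [-> ->]].
  case/allpairsP => -[i2 d2] [_ h2 [-> ->]] /= E; rewrite /= in h1 h2.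
  have Eij : i1 = i2 by rewrite -(lg i1 d1) // E lg.
  by move: E; rewrite Eij => /eqP; rewrite eqn_pmul2l ?expn_gt0 ?p0 // => /eqP ->.
move=> d; rewrite -dvdn_divisors ?muln_gt0 ?expn_gt0 ?p0 //.
apply/idP/allpairsP => [dd|[[i e] [/= hi he ->]]]; last first.
  move: hi he; rewrite mem_index_iota -dvdn_divisors // => hi he.
  by rewrite dvdn_mul // dvdn_exp2l // -ltnS; case/andP: hi.
have d0 : (0 < d)%N by apply: dvdn_gt0 dd; rewrite muln_gt0 expn_gt0 p0.
have [e ce Ed] := pfactor_coprime pp d0.
exists (logn p d, e); split; rewrite /= ?mem_index_iota //=.
- rewrite ltnS; have := dvdn_leq_log p _ dd; rewrite lg ?divisors_id //.
  by apply; rewrite muln_gt0 expn_gt0 p0.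
- rewrite -dvdn_divisors // -(Gauss_dvdr (n := p ^ k)) ?coprimeXr 1?coprime_sym //.
  by apply: dvdn_trans dd; rewrite Ed dvdn_mulr.
by rewrite mulnC.
Qed.

(** The sum is multiplicative in [q], and its factor at a prime power [p ^ k] is [k + 1] if
    [chi p = 1], and [1] or [0], according to the parity of [k], if [chi p = -1]. *)
Lemma divisor_sum_character q : (0 < q)%N ->
  (forall p, prime p -> (p %| q)%N -> chi p = 1 \/ chi p = -1) ->
  [/\ 0 <= \sum_(d <- divisors q) chi d,
      ((forall p, ~~ odd (logn p q)) -> 1 <= \sum_(d <- divisors q) chi d) &
      (\sum_(d <- divisors q) chi d != 0 ->
         forall p, odd (logn p q) -> chi p = 1)].
Proof.
elim/ltn_ind: q => q IH q0 H.
have [q1|q1] := leqP q 1.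
  have -> : q = 1%N by lia.
  rewrite big_seq1 chi1; split => // _ p; by rewrite logn1.
have pp := pdiv_prime q1; set p := pdiv q in pp.
have [m cm Eq] := pfactor_coprime pp q0.
have pm : ~~ (p %| m)%N by rewrite -prime_coprime.
have m0 : (0 < m)%N by move: q0; rewrite {1}Eq muln_gt0 => /andP [].
have k0 : (0 < logn p q)%N by rewrite logn_gt0 mem_primes pp q0 pdiv_dvd.
have mq : (m < q)%N.
  rewrite [ltnRHS]Eq -{1}[m]muln1 ltn_pmul2l // -{1}(expn0 p) ltn_exp2l //; exact: prime_gt1.
have [I1 I2 I3] : [/\ 0 <= \sum_(d <- divisors m) chi d,
      ((forall p, ~~ odd (logn p m)) -> 1 <= \sum_(d <- divisors m) chi d) &
      (\sum_(d <- divisors m) chi d != 0 ->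
         forall p, odd (logn p m) -> chi p = 1)].
  by apply: IH => // l pl lm; apply: H => //; rewrite Eq dvdn_mulr.
have lE l : l != p -> logn l q = logn l m.
  move=> lp; have pk0 : (0 < p ^ logn p q)%N by rewrite expn_gt0 prime_gt0.
  by rewrite {1}Eq (lognM _ m0 pk0) lognX (logn_prime _ pp) (negPf lp) muln0 addn0.
have lm : logn p m = 0%N by rewrite logn_coprime // prime_coprime.
have -> : \sum_(d <- divisors q) chi d =
    (\sum_(0 <= i < (logn p q).+1) chi p ^+ i) * \sum_(d <- divisors m) chi d.
  by rewrite {1}Eq mulnC divisor_sum_prime_power.
set S := \sum_(d <- divisors m) chi d in I1 I2 I3 *.
have G1 : chi p = 1 -> \sum_(0 <= i < (logn p q).+1) chi p ^+ i = (logn p q).+1%:Z.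
  move=> ->; under eq_bigr do rewrite expr1n.
  by rewrite sumr_const_nat subn0 -natz.
have G2 : chi p = -1 -> \sum_(0 <= i < (logn p q).+1) chi p ^+ i = if odd (logn p q) then 0 else 1.
  move=> ->; elim: (logn p q) => [|k IHk]; first by rewrite big_nat1.
  by rewrite big_nat_recr //= IHk -signr_odd /=; case: odd; rewrite ?expr0 ?expr1 ?add0r ?subrr.
case: (H p pp (pdiv_dvd q)) => cp.
  rewrite G1 //; split; first by rewrite mulr_ge0.
    move=> he; have : 1 <= S.
      apply: I2 => l; have [->|lp] := eqVneq l p; first by rewrite lm.
      by rewrite -lE.
    by move=> ?; nia.
  move=> n0 l ol; have [->//|lp] := eqVneq l p.
  by apply: I3; [apply: contraNneq n0 => ->; rewrite mulr0|rewrite -lE].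
rewrite G2 //; case: ifP => od.
  by rewrite mul0r; split => [||/eqP] // /(_ p); rewrite od.
rewrite mul1r; split => //.
  move=> he; apply: I2 => l; have [->|lp] := eqVneq l p; first by rewrite lm.
  by rewrite -lE.
move=> n0 l ol; have [E|lp] := eqVneq l p; first by rewrite E od in ol.
by apply: I3 => //; rewrite -lE.
Qed.
End CharacterDivisorSum.

(** * Quadratic characters modulo a squarefree number *)

Lemma periodic_sum_prefix (F : nat -> int) n : (0 < n)%N ->
  (forall a, F (a %% n)%N = F a) -> \sum_(0 <= a < n) F a = 0 ->
  forall v, \sum_(0 <= a < v) F a = \sum_(0 <= a < v %% n) F a.
Proof.
move=> n0 pF sF v; rewrite {1}(divn_eq v n); elim: (v %/ n)%N => [|k IH] //.
rewrite mulSn -addnA (big_cat_nat (leq0n n)) ?leq_addr //= sF add0r.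
rewrite -{1}[n]add0n big_addn addKn -IH.
by apply: eq_bigr => i _; rewrite -pF modnDr pF.
Qed.

Lemma periodic_sum_bound (F : nat -> int) n : (0 < n)%N ->
  (forall a, F (a %% n)%N = F a) -> \sum_(0 <= a < n) F a = 0 -> (forall a, `|F a| <= 1) ->
  forall u v, `|\sum_(u <= a < v) F a| <= (2 * n)%:Z.
Proof.
move=> n0 pF sF F1 u v.
have B w : `|\sum_(0 <= a < w) F a| <= n%:Z.
  rewrite (periodic_sum_prefix n0) //; apply: le_trans (ler_norm_sum _ _ _) _.
  apply: le_trans (ler_sum _ (fun i _ => F1 i)) _.
  by rewrite sumr_const_nat subn0 natz lez_nat ltnW // ltn_pmod.
have [vu|uv] := leqP v u; first by rewrite big_geq // normr0.
have -> : \sum_(u <= a < v) F a = \sum_(0 <= a < v) F a - \sum_(0 <= a < u) F a.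
  by rewrite (big_cat_nat (leq0n u) (ltnW uv)) /= addrAC subrr add0r.
apply: le_trans (ler_normB _ _) _; have := B u; have := B v; lia.
Qed.

Section QuadraticCharacters.
Variables (I : finType) (P : I -> nat).
Hypotheses (Pprime : forall i, prime (P i)) (Podd : forall i, odd (P i)) (Pinj : injective P).

Let n := (\prod_i P i)%N.

(** The real character modulo [n] attached to a set of prime divisors.  The squared symbols
    outside [A] only serve to make it vanish at numbers not coprime to [n]. *)
Definition quadratic_character (A : {set I}) (q : nat) : int :=
  \prod_i legendre (P i) q%:Z ^+ (if i \in A then 1 else 2).
Local Notation psi := quadratic_character.

Let n_gt0 : (0 < n)%N.
Proof. by rewrite /n; elim/big_ind: _ => [//|a b a0 b0|i _]; [rewrite muln_gt0 a0|exact: prime_gt0]. Qed.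

Lemma quadratic_character1 A : psi A 1 = 1.
Proof. by rewrite /psi big1 // => i _; rewrite legendre1 // expr1n. Qed.

Lemma quadratic_characterM A : {morph psi A : a b / (a * b)%N >-> a * b}.
Proof.
by move=> a b; rewrite /psi -big_split /=; apply: eq_bigr => i _; rewrite PoszM legendreM // exprMn.
Qed.

Lemma quadratic_character_periodic A a : psi A (a %% n)%N = psi A a.
Proof.
apply: eq_bigr => i _; rewrite (@legendre_eqmod _ _ a%:Z) //.
apply: (@dvdz_trans n%:Z); first by rewrite dvdzE /= /n (bigD1 i) //= dvdn_mulr.
by apply/dvdzP; exists (- (a %/ n)%N%:Z); lia.
Qed.

Let legendre_sqr i q : ~~ (P i %| q)%N -> legendre (P i) q%:Z ^+ 2 = 1.
Proof.
move=> iq; have : legendre (P i) q%:Z != 0 by rewrite legendre_eq0.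
by case: (legendre_values (P i) q%:Z) => ->.
Qed.

Lemma quadratic_character_norm A q : `|psi A q| <= 1.
Proof.
rewrite /psi normr_prod.
suff : 0 <= \prod_i `|legendre (P i) q%:Z ^+ (if i \in A then 1 else 2)| <= 1 by case/andP.
apply: (big_ind (fun x : int => 0 <= x <= 1)) => [//|x y|i _]; first by nia.
by rewrite normrX; case: (legendre_values (P i) q%:Z) => ->; case: ifP.
Qed.

Lemma quadratic_character0 q : (forall i, ~~ (P i %| q)%N) -> psi set0 q = 1.
Proof. by move=> H; rewrite /psi big1 // => i _; rewrite inE legendre_sqr. Qed.

Lemma quadratic_character_eq0 A i q : (P i %| q)%N -> psi A q = 0.
Proof.
move=> iq; rewrite /psi (bigD1 i) //=.
have -> : legendre (P i) q%:Z = 0 by apply/eqP; rewrite legendre_eq0.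
by rewrite expr0n; case: ifP; rewrite mul0r.
Qed.

Lemma quadratic_character_sum A : A != set0 -> \sum_(0 <= a < n) psi A a = 0.
Proof.
case/set0Pn => j jA.
have [g0 Eg0] := exists_nonresidue (Pprime j) (Podd j).
have us : uniq [seq P i | i <- enum I] by rewrite map_inj_uniq ?enum_uniq.
have ps : all prime [seq P i | i <- enum I] by apply/allP => p /mapP [i _ ->].
have [g Hg] := chinese_primes (fun p => if p == P j then g0 else 1%N) us ps.
have {}Hg i : g = (if i == j then g0 else 1%N) %[mod P i].
  by rewrite Hg ?(inj_eq Pinj) // map_f // mem_enum.
have Lg i : legendre (P i) g%:Z = if i == j then -1 else 1.
  have -> : legendre (P i) g%:Z = legendre (P i) (if i == j then g0 else 1%N)%:Z.
    apply: legendre_eqmod => //.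
    by rewrite -eqz_mod_dvd !modz_nat (Hg i).
  by case: eqP => [->|_] //; rewrite legendre1.
apply: (@sum_periodic_character (psi A) n g n_gt0).
- rewrite coprime_sym /n; elim/big_ind: _ => [|a b ca cb|i _]; rewrite ?coprime1n ?coprimeMl ?ca //.
  rewrite prime_coprime //; apply/negP => d.
  have : legendre (P i) g%:Z == 0 by rewrite legendre_eq0.
  by rewrite Lg; case: ifP.
- exact: quadratic_character_periodic.
- exact: quadratic_characterM.
rewrite /psi (bigD1 j) //= jA Lg eqxx big1 ?mulr1 // => i /negPf ij.
by rewrite Lg ij expr1n.
Qed.

(** The product selects the numbers [d * f] for which [c * d * f] is a square modulo every
    [P i].  Expanding it turns the pair of characters (all of the primes, none of them) into
    all pairs of complementary characters, because [x ^ 3 = x] for every value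
    [x] of the symbol. *)
Lemma genus_expansion (c : int) d f :
  psi setT d * psi set0 f * \prod_i (1 + legendre (P i) (c * (d * f)%N%:Z)) =
  \sum_(A : {set I}) (\prod_(i in A) legendre (P i) c) * (psi (~: A) d * psi A f).
Proof.
transitivity (psi setT d * psi set0 f * \sum_(A : {set I}) \prod_(i in A) legendre (P i) (c * (d * f)%N%:Z)).
  congr (_ * _); under eq_bigr do rewrite addrC.
  rewrite bigA_distr; apply: eq_bigr => A _.
  by rewrite [RHS]big_mkcond.
rewrite mulr_sumr; apply: eq_bigr => A _.
rewrite /psi [\prod_(i in A) _]big_mkcond [X in _ = X * _]big_mkcond -!big_split /=.
apply: eq_bigr => i _; rewrite !inE.
case: ifP => iA /=; last by rewrite mulr1 mul1r.
rewrite PoszM !legendreM //.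
by case: (legendre_values (P i) d%:Z) => ->; case: (legendre_values (P i) f%:Z) => ->;
  case: (legendre_values (P i) c) => ->.
Qed.
End QuadraticCharacters.

(** * Integers with prescribed quadratic characters *)

(** Each dyadic block contributes at least one half. *)
Lemma harmonic_unbounded (R : realFieldType) (B : nat) :
  exists K, B%:R <= \sum_(0 <= k < K) (k.+1%:R)^-1 :> R.
Proof.
exists (2 ^ (2 * B))%N.
suff H j : j%:R / 2 <= \sum_(0 <= k < 2 ^ j) (k.+1%:R)^-1 :> R.
  by apply: le_trans (H _); rewrite natrM mulrAC divff ?mul1r // pnatr_eq0.
elim: j => [|j IH]; first by rewrite mul0r sumr_ge0 // => k _; rewrite invr_ge0.
have le2 : (2 ^ j <= 2 ^ j.+1)%N by rewrite leq_exp2l.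
rewrite (big_cat_nat (leq0n _) le2) /= -natr1 mulrDl; apply: lerD => //.
apply: (@le_trans _ _ (\sum_(2 ^ j <= k < 2 ^ j.+1) ((2 ^ j.+1)%:R)^-1)).
  have t0 : (2 ^ j)%:R != 0 :> R by rewrite pnatr_eq0 -lt0n expn_gt0.
  rewrite sumr_const_nat (_ : 2 ^ j.+1 - 2 ^ j = 2 ^ j)%N; last by rewrite expnS; lia.
  by rewrite -mulr_natr expnS natrM le_eqVlt; apply/orP/or_introl/eqP; field.
rewrite [leLHS]big_nat [leRHS]big_nat; apply: ler_sum => k /andP [_ hk].
by rewrite lef_pV2 ?posrE ?ltr0n ?expn_gt0 // ler_nat.
Qed.

Lemma sum_subsequence (R : numDomainType) (F : nat -> R) (h : nat -> nat) K :
  (forall q, 0 <= F q) -> (forall k, h k < h k.+1)%N -> (0 < h 0)%N ->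
  \sum_(0 <= k < K) F (h k) <= \sum_(1 <= q < h K) F q.
Proof.
move=> F0 hh h0; have hp k : (0 < h k)%N by elim: k => [//|k /leq_trans]; apply; apply: ltnW.
elim: K => [|K IH]; first by rewrite big_geq // sumr_ge0.
rewrite big_nat_recr //= (big_cat_nat (hp K) (ltnW (hh K))) /=; apply: lerD => //.
by rewrite big_ltn // lerDl sumr_ge0.
Qed.

Section Genus.
Variables (R : rcfType) (I : finType) (P : I -> nat).
Hypotheses (Pprime : forall i, prime (P i)) (Podd : forall i, odd (P i)) (Pinj : injective P).
Variable c : int.
Hypothesis c_prod : \prod_i legendre (P i) c = 1.

Let n := (\prod_i P i)%N.
Let psi := quadratic_character P.
(** For [q] coprime to [n] this is the sum of the Jacobi symbols [(d / n)] over the divisors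
    of [q]; it is zero for the other [q]. *)
Let r q := \sum_(d <- divisors q) psi setT d * psi set0 (q %/ d)%N.
Let S q := \prod_i (1 + legendre (P i) (c * q%:Z)).

Let n_gt0 : (0 < n)%N.
Proof. by rewrite /n; elim/big_ind: _ => [//|a b a0 b0|i _]; [rewrite muln_gt0 a0|exact: prime_gt0]. Qed.

Let dvd_n i : (P i %| n)%N.
Proof. by rewrite /n (bigD1 i) //= dvdn_mulr. Qed.

Let psi_sqr A q : (forall i, ~~ (P i %| q)%N) -> psi A q ^+ 2 = 1.
Proof.
move=> Hq; rewrite /psi /quadratic_character -prodrXl big1 // => i _.
rewrite -exprM mulnC exprM.
suff -> : legendre (P i) q%:Z ^+ 2 = 1 by rewrite expr1n.
have : legendre (P i) q%:Z != 0 by rewrite legendre_eq0 //; apply: Hq.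
by case: (legendre_values (P i) q%:Z) => ->.
Qed.

Let r_coprime q : (0 < q)%N -> (forall i, ~~ (P i %| q)%N) ->
  r q = \sum_(d <- divisors q) psi setT d.
Proof.
move=> q0 Hq; rewrite /r big_seq [RHS]big_seq; apply: eq_bigr => d.
rewrite -dvdn_divisors // => dq; rewrite /psi quadratic_character0 ?mulr1 // => i.
by apply: contra (Hq i) => h; apply: dvdn_trans h _; apply: dvdn_div.
Qed.

Let r_eq0 i q : (0 < q)%N -> (P i %| q)%N -> r q = 0.
Proof.
move=> q0 iq; rewrite /r big_seq big1 // => d; rewrite -dvdn_divisors // => dq.
move: iq; rewrite -{1}(divnK dq) Euclid_dvdM // => /orP [] h.
  by rewrite /psi (quadratic_character_eq0 Pprime Podd set0 h) mulr0.
by rewrite /psi (quadratic_character_eq0 Pprime Podd setT h) mul0r.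
Qed.

Let r_properties q : (0 < q)%N -> (forall i, ~~ (P i %| q)%N) ->
  [/\ 0 <= r q, ((forall p, ~~ odd (logn p q)) -> 1 <= r q) &
      (r q != 0 -> forall p, odd (logn p q) -> psi setT p = 1)].
Proof.
move=> q0 Hq; rewrite r_coprime //; apply: divisor_sum_character => //.
- exact: quadratic_character1.
- exact: quadratic_characterM.
move=> p pp pq; have /eqP : psi setT p ^+ 2 = 1.
  by apply: psi_sqr => i; apply: contra (Hq i) => /dvdn_trans; apply.
by rewrite sqrf_eq1 => /orP [] /eqP; [left|right].
Qed.

Let r_ge0 q : 0 <= r q.
Proof.
case: (posnP q) => [->|q0].
  rewrite /r big_seq1 /psi quadratic_character1 // mul1r divn1 prodr_ge0 // => i _.
  by rewrite inE sqr_ge0.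
have [/forallP H|/forallPn [i]] := boolP [forall i, ~~ (P i %| q)%N].
  by case: (r_properties q0 H).
by rewrite negbK => h; rewrite (r_eq0 q0 h).
Qed.

Let H A N : R := \sum_(1 <= q < N.+1) inv_sqrt R q *
   \sum_(d <- divisors q) (psi (~: A) d)%:~R * (psi A (q %/ d)%N)%:~R.

Let H_bound A y : A != set0 -> A != setT -> (0 < y)%N ->
  `|H A (y ^ 2)| <= (2 * n)%:R ^+ 2 + 4 * (2 * n)%:R.
Proof.
move=> A0 AT y0.
have norm1 B i : `|(psi B i)%:~R : R| <= 1.
  by rewrite -intr_norm (ler_int _ _ 1); apply: quadratic_character_norm.
have sumB B : B != set0 -> forall u v, `|\sum_(u <= i < v) (psi B i)%:~R : R| <= (2 * n)%:R.
  move=> B0 u v; rewrite -rmorph_sum /= -intr_norm -[_%:R]/((2 * n)%:Z%:~R) ler_int.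
  apply: (@periodic_sum_bound (psi B) n n_gt0); first exact: quadratic_character_periodic.
    exact: quadratic_character_sum.
  exact: quadratic_character_norm.
apply: (@hyperbola_bound R (fun d => (psi (~: A) d)%:~R) (fun f => (psi A f)%:~R)) => //;
  last exact: sumB.
apply: sumB.
by apply: contraNneq AT => E; rewrite -[A]setCK E setC0.
Qed.

Let H_sym N : H setT N = H set0 N.
Proof.
rewrite /H setCT setC0.
exact: (divisor_sum_swap _ (fun d => (psi set0 d)%:~R) (fun d => (psi setT d)%:~R)).
Qed.

Let H0E N : H set0 N = \sum_(1 <= q < N.+1) inv_sqrt R q * (r q)%:~R.
Proof.
apply: eq_bigr => q _; congr (_ * _); rewrite /r setC0 rmorph_sum /=.
by apply: eq_bigr => d _; rewrite rmorphM.
Qed.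

Let expansion N : \sum_(1 <= q < N.+1) inv_sqrt R q * (r q * S q)%:~R =
  \sum_(A : {set I}) (\prod_(i in A) legendre (P i) c)%:~R * H A N.
Proof.
under [RHS]eq_bigr do rewrite mulr_sumr.
rewrite exchange_big /=; rewrite big_nat [RHS]big_nat; apply: eq_bigr => q /andP [q0 _].
transitivity (inv_sqrt R q * \sum_(A : {set I}) (\prod_(i in A) legendre (P i) c)%:~R *
   \sum_(d <- divisors q) (psi (~: A) d)%:~R * (psi A (q %/ d)%N)%:~R); last first.
  by rewrite mulr_sumr; apply: eq_bigr => A _; rewrite mulrCA.
congr (_ * _).
under [RHS]eq_bigr do rewrite mulr_sumr.
rewrite exchange_big /= /r mulr_suml rmorph_sum /= big_seq [RHS]big_seq.
apply: eq_bigr => d; rewrite -dvdn_divisors // => dq.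
have Eq : (d * (q %/ d))%N = q by rewrite mulnC divnK.
have := genus_expansion Pprime Podd c d (q %/ d); rewrite Eq -/psi => /(congr1 (fun z : int => z%:~R : R)) ->.
by rewrite rmorph_sum /=; apply: eq_bigr => A _; rewrite !rmorphM.
Qed.

(** Already the squares [q = (n k + 1)^2], where [r q >= 1], contribute a harmonic sum in
    arithmetic progression. *)
Let H0_unbounded (B : nat) : exists2 y, (0 < y)%N & B%:R < H set0 (y ^ 2).
Proof.
have [K HK] := harmonic_unbounded R (n * B.+1).
exists (n * K).+1 => //; rewrite H0E.
pose F q := inv_sqrt R q * (r q)%:~R.
have F0 q : 0 <= F q by rewrite mulr_ge0 ?inv_sqrt_ge0 // ler0z.
pose h k := ((n * k).+1 ^ 2)%N.
have hS k : (h k < h k.+1)%N by rewrite /h ltn_sqr ltnS ltn_pmul2l.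
have L := @sum_subsequence R F h K F0 hS isT.
have a1 : (1 <= h K)%N by rewrite expn_gt0.
have a2 : (h K <= ((n * K).+1 ^ 2).+1)%N := leqnSn _.
rewrite (big_cat_nat a1 a2) /=.
apply: (@lt_le_trans _ _ (\sum_(0 <= k < K) F (h k))); last first.
  by apply: le_trans L _; rewrite lerDl; apply: sumr_ge0 => q _; apply: F0.
have n0 : 0 < (n%:R : R) by rewrite ltr0n.
apply: (@lt_le_trans _ _ (n%:R^-1 * \sum_(0 <= k < K) (k.+1%:R)^-1)).
  rewrite -(ltr_pM2l n0) mulrA divff ?gt_eqF // mul1r.
  by apply: lt_le_trans HK; rewrite natrM ltr_pM2l // ltr_nat.
rewrite mulr_sumr; apply: ler_sum => k _.
have r1 : 1 <= r (h k).
  have [||_ R1 _] := @r_properties (h k); first by rewrite expn_gt0.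
    move=> i; rewrite /h Euclid_dvdX // andbT -addn1 dvdn_addr ?dvdn1 ?dvdn_mulr //.
    by rewrite gtn_eqF // prime_gt1.
  by apply: R1 => p; rewrite lognX mul2n odd_double.
have -> : F (h k) = ((n * k).+1%:R)^-1 * (r (h k))%:~R.
  by rewrite /F /h /inv_sqrt natrX sqrtr_sqr ger0_norm.
rewrite -invfM -natrM; apply: (@le_trans _ _ ((n * k).+1%:R^-1)).
  by rewrite lef_pV2 ?posrE ?ltr0n ?muln_gt0 ?n_gt0 // ler_nat; have := n_gt0; lia.
by rewrite ler_peMr ?invr_ge0 // (ler_int _ 1).
Qed.

(** If no [q <= y ^ 2] had [r q] and [S q] both nonzero, the weighted sum of [r q * S q]
    would vanish.  In its expansion over the subsets [A], the terms other than [set0] and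
    [setT] are bounded independently of [y], the term [setT] is nonnegative because the
    symbols of [c] multiply to one, and the term [set0] is unbounded. *)
Lemma genus_representative :
  exists q, [/\ (0 < q)%N, forall i, legendre (P i) (c * q%:Z) = 1 &
     forall p, odd (logn p q) -> \prod_i legendre (P i) p%:Z = 1].
Proof.
pose C := ((2 * n) ^ 2 + 4 * (2 * n))%N.
(* [C] is the bound of the hyperbola method for characters whose interval sums are at most [2 n]. *)
have [y y0 Hy] := H0_unbounded (#|{set I}| * C).
have [/hasP [q] | /hasPn none] := boolP (has (fun q => (r q != 0) && (S q != 0)) (index_iota 1 (y ^ 2).+1)).
  rewrite mem_index_iota => /andP [q0 _] /andP [rq Sq]; exists q.
  have Hq i : ~~ (P i %| q)%N by apply: contraNN rq => h; rewrite (r_eq0 q0 h).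
  have [_ _ /(_ rq) odd1] := r_properties q0 Hq.
  split => // [i|p op]; last first.
    by rewrite -[RHS](odd1 p op); apply: eq_bigr => i _; rewrite inE.
  have c0 : legendre (P i) c != 0.
    by apply/eqP => c0; move: c_prod; rewrite (bigD1 i) //= c0 mul0r.
  have q0' : legendre (P i) q%:Z != 0 by rewrite legendre_eq0 //; apply: Hq.
  move: Sq; rewrite /S (bigD1 i) //= mulf_eq0 negb_or => /andP [+ _].
  rewrite legendreM //; move: c0 q0'.
  by case: (legendre_values (P i) c) => ->; case: (legendre_values (P i) q%:Z) => ->.
exfalso; have := expansion (y ^ 2).
rewrite big_nat big1 => [|q hq]; last first.
  have := none q; rewrite mem_index_iota => /(_ hq); rewrite negb_and !negbK.
  by case/orP => /eqP ->; rewrite ?mul0r ?mulr0.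
rewrite (bigD1 set0) //= big_set0 mul1r => E.
have : \sum_(A : {set I} | A != set0) (\prod_(i in A) legendre (P i) c)%:~R * H A (y ^ 2)
   >= \sum_(A : {set I} | A != set0) - C%:R.
  apply: ler_sum => A A0; have [->|AT] := eqVneq A setT.
    rewrite (eq_bigl (fun=> true)) ?c_prod ?mul1r => [|i]; last by rewrite inE.
    rewrite H_sym; apply: (@le_trans _ _ 0); first by rewrite oppr_le0.
    by apply: le_trans (ltW Hy).
  have cb : `|\prod_(i in A) legendre (P i) c| <= 1.
    rewrite normr_prod.
    suff : 0 <= \prod_(i in A) `|legendre (P i) c| <= 1 by case/andP.
    apply: (big_ind (fun x : int => 0 <= x <= 1)) => [//|x z|i _]; first by nia.
    by case: (legendre_values (P i) c) => ->.
  have := H_bound A0 AT y0; set h := H A _ => hb.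
  have : `|(\prod_(i in A) legendre (P i) c)%:~R * h| <= C%:R.
    rewrite normrM -intr_norm -[leRHS]mul1r ler_pM ?ler0z // ?(ler_int _ _ 1) //.
    by rewrite /C natrD natrX [X in _ <= _ + X]natrM.
  by rewrite ler_norml => /andP [].
rewrite sumr_const mulNrn -mulrnA mulnC => L.
have : (#|[pred A : {set I} | A != set0]| * C <= #|{set I}| * C)%N by rewrite leq_mul2r max_card orbT.
rewrite -(ler_nat R) => L2.
move: Hy L L2 E; set x := H _ _; set z := \sum_(_ | _) _; lra.
Qed.
End Genus.

(** * Sums of three squares *)

Lemma square_mod_prod_primes (s : seq nat) (a : int) : uniq s -> all prime s -> all odd s ->
  (forall p, p \in s -> legendre p a = 1) ->
  exists x : nat, ((\prod_(p <- s) p)%N %| x%:Z ^+ 2 - a)%Z.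
Proof.
move=> us ps os Hs.
have root p : exists x : nat, p \in s -> (p %| x%:Z ^+ 2 - a)%Z.
  have [ip|] := boolP (p \in s); last by exists 0%N.
  have [x Hx] := legendre_eq1_square (allP ps p ip) (allP os p ip) (Hs p ip).
  by exists x.
have [r Hr] : exists r : nat -> nat, forall p, p \in s -> (p %| (r p)%:Z ^+ 2 - a)%Z.
  have ex p : exists x : nat, (p \in s) ==> (p %| x%:Z ^+ 2 - a)%Z.
    by have [x Hx] := root p; exists x; apply/implyP.
  by exists (fun p => xchoose (ex p)) => p; apply/implyP/(xchooseP (ex p)).
have [x Hx] := chinese_primes r us ps.
exists x; rewrite dvdzE; apply: prod_primes_dvd => // p ip.
rewrite -[(_ %| _)%N]/((p %| x%:Z ^+ 2 - a)%Z).
have -> : x%:Z ^+ 2 - a = (x%:Z - (r p)%:Z) * (x%:Z + (r p)%:Z) + ((r p)%:Z ^+ 2 - a) by ring.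
apply: rpredD (Hr p ip); rewrite dvdz_mulr // -eqz_mod_dvd !modz_nat.
by rewrite (Hx p ip).
Qed.

(** For a product congruent to 3 modulo 4, its opposite is the product of the numbers
    [(-1 / l) * l], to which reciprocity applies factor by factor. *)
Lemma legendre_minus_prod (s : seq nat) p : all prime s -> all odd s ->
  (\prod_(l <- s) l = 3 %[mod 4])%N -> prime p -> odd p ->
  \prod_(l <- s) legendre l p%:Z = 1 ->
  legendre p (- (\prod_(l <- s) l)%N%:Z) = 1.
Proof.
move=> ps os s3 pp op sp.
have E : - (\prod_(l <- s) l)%N%:Z = \prod_(l <- s) (legendre l (-1) * l%:Z).
  rewrite big_split /= (prod_legendre_sign (sg := sign_mod4)) //.
  - by rewrite /sign_mod4 s3 mulN1r (big_morph Posz PoszM (erefl 1%:Z)).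
  - exact: sign_mod4M.
  - exact: legendre_minus1.
rewrite E (big_morph (legendre p) (legendreM pp op) (legendre1 pp op)).
transitivity (\prod_(l <- s) legendre l p%:Z) => //.
rewrite big_seq [RHS]big_seq; apply: eq_bigr => l ls.
apply: legendre_reciprocity; rewrite ?(allP ps l ls) ?(allP os l ls) //.
apply/eqP => lp; move/eqP: sp; rewrite (big_rem l ls) /= lp.
have -> : legendre p p%:Z = 0 by apply/eqP; rewrite legendre_eq0 // dvdzz.
by rewrite mul0r.
Qed.

Lemma odd_sqr_mod8 b : odd b -> (b ^ 2 %% 8 = 1)%N.
Proof.
move=> ob; have b8 : (b %% 8 \in [:: 1; 3; 5; 7])%N by rewrite !inE; lia.
by rewrite -modnXm; move: b8; rewrite !inE => /or4P [] /eqP ->.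
Qed.

Lemma odd_sqr_mod4 b : odd b -> (b ^ 2 %% 4 = 1)%N.
Proof. by move=> ob; rewrite -(@modn_dvdm 8) // odd_sqr_mod8. Qed.

(** Since [(-2 / p)] multiplies to one over the primes [p] of [n = 3 mod 8], there is [q0] in
    the genus described by [genus_representative].  Dropping its square part leaves a
    squarefree [q]; its primes [p] satisfy [(p / n) = 1], so they are odd, as
    [(2 / n) = -1], and [- n] is a square modulo each of them. *)
Lemma three_squares_auxiliary (s : seq nat) : uniq s -> all prime s -> all odd s ->
  (\prod_(p <- s) p = 3 %[mod 8])%N ->
  exists q t b : nat, [/\ (0 < q)%N, (\prod_(p <- s) p %| 2 * q * t ^ 2 + 1)%N &
    (4 * q %| b ^ 2 + \prod_(p <- s) p)%N].
Proof.
move=> us ps os; set n := (\prod_(p <- s) p)%N => n3.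
have n34 : (n = 3 %[mod 4])%N by rewrite -(@modn_dvdm 8 n) // n3.
pose P (i : 'I_(size s)) := nth 0%N s i.
have Ps i : P i \in s by apply: mem_nth.
have prodE (F : nat -> int) : \prod_(p <- s) F p = \prod_i F (P i).
  by rewrite (big_nth 0%N) big_mkord.
have Pinj : injective P.
  by move=> i j /eqP; rewrite nth_uniq // => /eqP /val_inj.
have c1 : \prod_i legendre (P i) (-2) = 1.
  rewrite -(prodE (fun p => legendre p (-2))).
  transitivity (\prod_(p <- s) (legendre p (-1) * legendre p 2)).
    rewrite big_seq [RHS]big_seq; apply: eq_bigr => p ip.
    by rewrite -legendreM ?(allP ps) ?(allP os).
  rewrite big_split /= (prod_legendre_sign (sg := sign_mod4)) // ?(prod_legendre_sign (sg := sign_mod8)) //.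
  - by rewrite -/n /sign_mod4 /sign_mod8 n34 n3.
  - exact: sign_mod8M.
  - exact: legendre_2.
  - exact: sign_mod4M.
  - exact: legendre_minus1.
have [q0 [q00 Hq Hodd]] := @genus_representative realalg _ P (fun i => allP ps _ (Ps i))
  (fun i => allP os _ (Ps i)) Pinj (-2) c1.
have [f Ef] := square_times_primes q00.
set s' := [seq p <- primes q0 | odd (logn p q0)] in Ef.
set q := (\prod_(p <- s') p)%N in Ef.
have us' : uniq s' by rewrite filter_uniq ?primes_uniq.
have ps' : all prime s'.
  by apply/allP => p; rewrite mem_filter mem_primes => /and3P [].
have sp p : p \in s' -> \prod_(l <- s) legendre l p%:Z = 1.
  rewrite mem_filter => /andP [op _]; rewrite (prodE (fun l => legendre l p%:Z)).
  exact: Hodd.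
have os' : all odd s'.
  apply/allP => p ip; have pp := allP ps' p ip.
  apply: contraT => ep; have p2 : p = 2%N by case: (even_prime pp) => // op; rewrite op in ep.
  move: (sp p ip); rewrite p2 (prod_legendre_sign (sg := sign_mod8)) //.
  - by rewrite -/n /sign_mod8 n3.
  - exact: sign_mod8M.
  - exact: legendre_2.
have q_gt0 : (0 < q)%N by move: q00; rewrite Ef muln_gt0 => /andP [].
have oq : odd q by apply: prod_odd.
have sq p : p \in s -> legendre p (-2 * q%:Z) = 1.
  move=> ip; have [pp op] := (allP ps p ip, allP os p ip).
  have ix : (index p s < size s)%N by rewrite index_mem.
  move: (Hq (Ordinal ix)); rewrite /P /= nth_index // Ef PoszM mulrCA legendreM // PoszM legendreM //.
  by case: (legendre_values p f) => ->; rewrite ?mul0r // ?mulN1r ?opprK ?mul1r.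
have [x Hx] : exists x : nat, (n %| x%:Z ^+ 2 - (-2 * q%:Z))%Z.
  exact: square_mod_prod_primes.
have [y Hy] : exists y : nat, (q %| y%:Z ^+ 2 - (- n%:Z))%Z.
  apply: square_mod_prod_primes => // p ip.
  have [pp op] := (allP ps' p ip, allP os' p ip).
  exact: legendre_minus_prod (sp p ip).
have cq : coprime (2 * q) n.
  rewrite coprimeMl coprime2n prod_odd //= /n big_seq.
  apply: (big_ind (fun m => coprime q m)) => [|a b ca cb|p ip]; first exact: coprimen1.
    by rewrite coprimeMr ca.
  rewrite coprime_sym prime_coprime ?(allP ps p ip) //; apply/negP => pq.
  have : legendre p (-2 * q%:Z) = 0.
    apply/eqP; rewrite legendre_eq0 ?(allP ps p ip) ?(allP os p ip) //.
    by rewrite dvdz_mull.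
  by rewrite sq.
have [u Hu] : exists u : nat, (n %| 2 * q%:Z * u%:Z - 1)%Z.
  exists ((2 * q) ^ (totient n).-1)%N.
  have tn : (0 < totient n)%N.
    by rewrite totient_gt0 lt0n; apply/eqP => n0; move: n3; rewrite n0.
  rewrite -!PoszM -expnS prednK // -eqz_mod_dvd !modz_nat.
  by rewrite (Euler_exp_totient cq).
(* [b] must be odd for [4] to divide [b ^ 2 + n]; adding the odd [q] changes the parity. *)
exists q, (x * u)%N, (if odd y then y else (y + q)%N).
split => //.
- rewrite -[(_ %| _)%N]/((n%:Z %| (2 * q * (x * u) ^ 2 + 1)%N%:Z)%Z).
  have -> : (2 * q * (x * u) ^ 2 + 1)%N%:Z = 2 * q%:Z * u%:Z ^+ 2 * (x%:Z ^+ 2 - (-2 * q%:Z))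
     - (2 * q%:Z * u%:Z - 1) * (2 * q%:Z * u%:Z + 1).
    by rewrite !expnS !expn0 !(PoszD, PoszM); ring.
  by apply: rpredB; [apply: dvdz_mull|apply: dvdz_mulr].
set b := (if _ then _ else _).
have ob : odd b by rewrite /b; case: ifP => // oy; rewrite oddD oy oq.
have c4 : coprime 4 q by rewrite -[4%N]/(2 ^ 2)%N coprime_pexpl // coprime2n.
rewrite Gauss_dvd //; apply/andP; split.
  by rewrite /dvdn -modnDm n34 (odd_sqr_mod4 ob).
rewrite -[(_ %| _)%N]/((q%:Z %| (b ^ 2 + n)%N%:Z)%Z).
have -> : (b ^ 2 + n)%N%:Z = (y%:Z ^+ 2 - (- n%:Z)) + (b%:Z - y%:Z) * (b%:Z + y%:Z).
  by rewrite !expnS !expn0 !(PoszD, PoszM); ring.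
apply: rpredD Hy _; apply: dvdz_mulr; rewrite /b; case: ifP => _; first by rewrite subrr dvdz0.
by rewrite PoszD addrC addKr dvdzz.
Qed.

Local Open Scope Z_scope.

(** Gauss's theorem in the class of 3 modulo 8.  The square part of [N] is odd, hence
    congruent to one modulo 8, so the squarefree part stays in the class. *)
Theorem three_squares (N : Z) : 0 < N -> N mod 8 = 3 ->
  exists X Y Z : Z, N = X * X + Y * Y + Z * Z.
Proof.
move=> N0 N8.
have [k Ek] : exists k : nat, N = Z.of_nat k by exists (Z.to_nat N); lia.
subst N.
have := Z.div_mod (Z.of_nat k) 8 (ltac:(lia)); rewrite N8 => Hk.
have {Hk} k8 : (k %% 8 = 3)%N by lia.
have k0 : (0 < k)%N by lia.
have [f Ef] := square_times_primes k0.
move: Ef; set s := [seq p <- primes k | odd (logn p k)] => Ef.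
have us : uniq s by rewrite filter_uniq ?primes_uniq.
have ps : all prime s.
  by apply/allP => p; rewrite mem_filter mem_primes => /and3P [].
have ok : odd k by lia.
have os : all odd s.
  apply/allP => p; rewrite mem_filter mem_primes => /and4P [_ _ _ pk].
  exact: dvdn_odd pk ok.
move: Ef; set n := (\prod_(p <- s) p)%N => Ef.
have n3 : (n = 3 %[mod 8])%N.
  have of2 : odd f by move: ok; rewrite Ef oddM oddX => /andP [].
  have f1 := odd_sqr_mod8 of2.
  by move: k8; rewrite [in LHS]Ef -modnMml f1 mul1n.
have [q [t [b [q0 /dvdnP [w Hw] /dvdnP [h Hh]]]]] := three_squares_auxiliary us ps os n3.
rewrite -/n in Hw Hh.
have [X [Y [Z E]]] : exists X Y Z : Z, Z.of_nat n = X * X + Y * Y + Z * Z.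
  by apply: (@three_squares_of_auxiliary (Z.of_nat n) (Z.of_nat q) (Z.of_nat t)
    (Z.of_nat w) (Z.of_nat b) (Z.of_nat h)); lia.
exists (Z.of_nat f * X), (Z.of_nat f * Y), (Z.of_nat f * Z).
transitivity (Z.of_nat f * Z.of_nat f * Z.of_nat n); first by (rewrite [in LHS]Ef; lia).
by rewrite E; ring.
Qed.

End ThreeSquares.

(** * Six dodecahedral numbers in three pairs *)

Lemma odd_summands (X Y Z T : Z) : X * X + Y * Y + Z * Z = 3 + 8 * T ->
  exists x y z, X = 2 * x + 1 /\ Y = 2 * y + 1 /\ Z = 2 * z + 1.
Proof.
  assert (H : forall u, exists v, u = 2 * v + 1 \/ u * u = 4 * v).
  { intros u. destruct (Z.Even_or_Odd u) as [[v ->] | [v ->]].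
    - exists (v * v). right. ring.
    - exists v. now left. }
  assert (H' : forall u v, u = 2 * v + 1 -> u * u = 4 * (v * v + v) + 1) by (intros; subst; ring).
  destruct (H X) as [x [hx | hx]], (H Y) as [y [hy | hy]], (H Z) as [z [hz | hz]];
    try rewrite (H' _ _ hx); try rewrite (H' _ _ hy); try rewrite (H' _ _ hz); intros E; try lia.
  now exists x, y, z.
Qed.

(** In terms of [u = 3 n - 1] a dodecahedral number is [(u ^ 3 - u) / 6].  The two numbers
    [u] of this pair are [(s + 3 e) / 2] and [(s - 3 e) / 2] with [s = 6 a + 1] and
    [e = 2 j + 1], so the terms of odd degree in [e] cancel. *)
Lemma pair_sum (a j : Z) :
  24 * (dodecahedral (a + j + 1) + dodecahedral (a - j)) =
  (6 * a + 1) * ((6 * a + 1) ^ 2 - 4 + 27 * (2 * j + 1) ^ 2).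
Proof.
  replace (24 * (dodecahedral (a + j + 1) + dodecahedral (a - j)))
    with (12 * (2 * dodecahedral (a + j + 1) + 2 * dodecahedral (a - j))) by ring.
  rewrite !dodecahedral_double. ring.
Qed.

(** Three pairs with the same [s = 6 a + 1] and odd [e] whose squares add up to [3 + 8 T].
    The upper bound on [T] keeps [3 |e| <= s - 4], so that all indices are positive. *)
Lemma six_dodecahedral (a T : Z) : 0 < a -> 0 <= T -> 9 * (3 + 8 * T) <= (6 * a - 3) ^ 2 ->
  exists n1 n2 n3 n4 n5 n6, 0 < n1 /\ 0 < n2 /\ 0 < n3 /\ 0 < n4 /\ 0 < n5 /\ 0 < n6 /\
    8 * (dodecahedral n1 + dodecahedral n2 + dodecahedral n3 + dodecahedral n4
         + dodecahedral n5 + dodecahedral n6)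
    = (6 * a + 1) ^ 3 + 23 * (6 * a + 1) + 72 * (6 * a + 1) * T.
Proof.
  intros ha hT hb.
  destruct (@ThreeSquares.three_squares (3 + 8 * T)) as (X & Y & Z & E); [lia | |].
  { rewrite (Z.mul_comm 8 T), Z.mod_add by lia. reflexivity. }
  destruct (odd_summands X Y Z T (eq_sym E)) as (x & y & z & -> & -> & ->).
  assert (pos : forall u, 9 * ((2 * u + 1) * (2 * u + 1)) <= (6 * a - 3) ^ 2 ->
    0 < a + u + 1 /\ 0 < a - u) by (intros u hu; nia).
  pose proof (Z.square_nonneg (2 * x + 1)).
  pose proof (Z.square_nonneg (2 * y + 1)).
  pose proof (Z.square_nonneg (2 * z + 1)).
  destruct (pos x) as [p1 p2]; [lia |].
  destruct (pos y) as [p3 p4]; [lia |].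
  destruct (pos z) as [p5 p6]; [lia |].
  exists (a + x + 1), (a - x), (a + y + 1), (a - y), (a + z + 1), (a - z).
  repeat (split; [assumption |]).
  pose proof (pair_sum a x). pose proof (pair_sum a y). pose proof (pair_sum a z).
  apply (Z.mul_reg_l _ _ 3); [lia |].
  set (s := 6 * a + 1) in *.
  transitivity (s * (s ^ 2 - 4 + 27 * (2 * x + 1) ^ 2) + s * (s ^ 2 - 4 + 27 * (2 * y + 1) ^ 2)
    + s * (s ^ 2 - 4 + 27 * (2 * z + 1) ^ 2)); [lia |].
  transitivity (3 * s ^ 3 - 12 * s + 27 * s * (3 + 8 * T)); [rewrite E |]; ring.
Qed.

(** * Two dodecahedral numbers in a residue class *)

(** The polynomial [2 * dodecahedral n], with its first two derivatives. *)
Definition cubic (n : Z) : Z := 9 * n ^ 3 - 9 * n ^ 2 + 2 * n.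
Definition cubic' (n : Z) : Z := 27 * n ^ 2 - 18 * n + 2.
Definition cubic'' (n : Z) : Z := 54 * n - 18.

Lemma cubic_double (n : Z) : cubic n = 2 * dodecahedral n.
Proof. rewrite dodecahedral_double. unfold cubic. ring. Qed.

Lemma cubic_shift (n h : Z) :
  cubic (n + h) = cubic n + h * cubic' n + h ^ 2 * (27 * n - 9 + 9 * h).
Proof. unfold cubic, cubic'. ring. Qed.

Lemma cubic'_shift (n h : Z) : cubic' (n + h) = cubic' n + h * cubic'' n + h ^ 2 * 27.
Proof. unfold cubic', cubic''. ring. Qed.

Lemma cubic''_shift (n h : Z) : cubic'' (n + h) = cubic'' n + h * 54.
Proof. unfold cubic''. ring. Qed.

(** The number inverted by [d] is the Jacobian determinant of the two equations, so [al] and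
    [be] come from Cramer's rule. *)
Lemma hensel_two_equations (C g x0 y0 d : Z) :
  (7 | cubic x0 + cubic y0 - C) -> (7 | cubic' y0 - g * cubic' x0) ->
  (7 | d * (cubic' x0 * cubic'' y0 + g * cubic' y0 * cubic'' x0) - 1) ->
  forall i : nat, exists x y,
    (7 ^ Z.of_nat (S i) | cubic x + cubic y - C) /\
    (7 ^ Z.of_nat (S i) | cubic' y - g * cubic' x).
Proof.
  intros H1 H2 H3 i.
  cut (exists x y, (7 ^ Z.of_nat (S i) | cubic x + cubic y - C) /\
    (7 ^ Z.of_nat (S i) | cubic' y - g * cubic' x) /\
    (7 | d * (cubic' x * cubic'' y + g * cubic' y * cubic'' x) - 1)).
  { intros (x & y & h1 & h2 & _). now exists x, y. }
  induction i as [|i (x & y & [p hp] & [e he] & [u hu])].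
  - exists x0, y0. now repeat split.
  - rewrite (Nat2Z.inj_succ (S i)), Z.pow_succ_r by lia.
    assert (HM : exists M', 7 ^ Z.of_nat (S i) = 7 * M').
    { exists (7 ^ Z.of_nat i). rewrite Nat2Z.inj_succ, Z.pow_succ_r by lia. reflexivity. }
    destruct HM as [M' HM]. set (M := 7 ^ Z.of_nat (S i)) in *. clearbody M.
    set (al := - d * (cubic'' y * p - cubic' y * e)).
    set (be := - d * (cubic' x * e + g * cubic'' x * p)).
    exists (x + M * al), (y + M * be).
    rewrite !cubic_shift, !cubic'_shift, !cubic''_shift.
    set (D := cubic' x * cubic'' y + g * cubic' y * cubic'' x) in *.
    assert (E1 : cubic' x * al + cubic' y * be = - (d * D) * p) by (unfold al, be, D; ring).
    assert (E2 : cubic'' y * be - g * cubic'' x * al = - (d * D) * e) by (unfold al, be, D; ring).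
    assert (Hd : d * D = 1 + 7 * u) by lia.
    rewrite Hd in E1, E2.
    repeat split.
    + exists (- u * p + M' * (al ^ 2 * (27 * x - 9 + 9 * (M * al)) + be ^ 2 * (27 * y - 9 + 9 * (M * be)))).
      transitivity ((cubic x + cubic y - C) + M * (cubic' x * al + cubic' y * be)
        + M * M * (al ^ 2 * (27 * x - 9 + 9 * (M * al)) + be ^ 2 * (27 * y - 9 + 9 * (M * be)))); [ring |].
      rewrite hp, E1. rewrite HM at 3. ring.
    + exists (- u * e + M' * 27 * (be ^ 2 - g * al ^ 2)).
      transitivity ((cubic' y - g * cubic' x) + M * (cubic'' y * be - g * cubic'' x * al)
        + M * M * 27 * (be ^ 2 - g * al ^ 2)); [ring |].
      rewrite he, E2. rewrite HM at 3. ring.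
    + rewrite HM. unfold D in Hd.
      set (a1 := cubic' x) in *. set (a2 := cubic'' x) in *.
      set (b1 := cubic' y) in *. set (b2 := cubic'' y) in *.
      set (A := M' * al). set (B := M' * be).
      replace (7 * M' * al) with (7 * A) by (unfold A; ring).
      replace (7 * M' * be) with (7 * B) by (unfold B; ring).
      set (U := A * a2 + 7 * A ^ 2 * 27). set (V := B * b2 + 7 * B ^ 2 * 27).
      exists (u + d * ((a1 + 7 * U) * B * 54 + U * b2 + g * ((b1 + 7 * V) * A * 54 + V * a2))).
      transitivity (d * ((a1 + 7 * U) * (b2 + 7 * B * 54) + g * (b1 + 7 * V) * (a2 + 7 * A * 54)) - 1).
      * unfold U, V. ring.
      * transitivity (d * (a1 * b2 + g * b1 * a2) - 1 + 7 * (d * ((a1 + 7 * U) * B * 54 + U * b2 + g * ((b1 + 7 * V) * A * 54 + V * a2)))); [ring |].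
        rewrite Hd. ring.
Qed.

(** The derivative is [3 u ^ 2 - 1] with [u = 3 n - 1], and three is not a square modulo 7. *)
Lemma cubic'_unit_mod7 (x : Z) : exists d, (7 | d * cubic' x - 1).
Proof.
  pose proof (Z.div_mod x 7 ltac:(lia)) as E.
  pose proof (Z.mod_pos_bound x 7 ltac:(lia)) as B.
  set (w := x / 7) in *. set (r := x mod 7) in *. clearbody w r.
  assert (R : r = 0 \/ r = 1 \/ r = 2 \/ r = 3 \/ r = 4 \/ r = 5 \/ r = 6) by lia.
  subst x. unfold cubic'.
  destruct R as [-> | [-> | [-> | [-> | [-> | [-> | ->]]]]]].
  - exists 4, (4 * (189 * w ^ 2 + 54 * 0 * w - 18 * w) + 1). ring.
  - exists 2, (2 * (189 * w ^ 2 + 54 * 1 * w - 18 * w) + 3). ring.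
  - exists 2, (2 * (189 * w ^ 2 + 54 * 2 * w - 18 * w) + 21). ring.
  - exists 4, (4 * (189 * w ^ 2 + 54 * 3 * w - 18 * w) + 109). ring.
  - exists 3, (3 * (189 * w ^ 2 + 54 * 4 * w - 18 * w) + 155). ring.
  - exists 6, (6 * (189 * w ^ 2 + 54 * 5 * w - 18 * w) + 503). ring.
  - exists 3, (3 * (189 * w ^ 2 + 54 * 6 * w - 18 * w) + 371). ring.
Qed.

(** Newton's iteration with an inverse of the derivative modulo 7. *)
Lemma hensel_lift (C x : Z) (i : nat) :
  (7 ^ Z.of_nat (S i) | cubic x - C) ->
  forall j : nat, exists x', (7 ^ Z.of_nat (S i) | x' - x) /\
    (7 ^ (Z.of_nat (S i) + Z.of_nat j) | cubic x' - C).
Proof.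
  intros H j. induction j as [|j (x1 & h1 & [p hp])].
  - exists x. split; [rewrite Z.sub_diag; apply Z.divide_0_r |].
    now rewrite Z.add_0_r.
  - destruct (cubic'_unit_mod7 x1) as [d [u hu]].
    assert (HM : exists M', 7 ^ (Z.of_nat (S i) + Z.of_nat j) = 7 * M').
    { exists (7 ^ (Z.of_nat i + Z.of_nat j)). rewrite <- Z.pow_succ_r by lia. f_equal. lia. }
    assert (HS : (7 ^ Z.of_nat (S i) | 7 ^ (Z.of_nat (S i) + Z.of_nat j))).
    { rewrite Z.pow_add_r by lia. apply Z.divide_factor_l. }
    replace (Z.of_nat (S i) + Z.of_nat (S j)) with (Z.succ (Z.of_nat (S i) + Z.of_nat j)) by lia.
    rewrite Z.pow_succ_r by lia.
    set (M := 7 ^ (Z.of_nat (S i) + Z.of_nat j)) in *. clearbody M.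
    destruct HM as [M' HM].
    exists (x1 + M * (- d * p)). split.
    + replace (x1 + M * (- d * p) - x) with ((x1 - x) + M * (- d * p)) by ring.
      apply Z.divide_add_r; [assumption |]. now apply Z.divide_mul_l.
    + rewrite cubic_shift.
      exists (- u * p + M' * ((- d * p) ^ 2 * (27 * x1 - 9 + 9 * (M * (- d * p))))).
      transitivity ((cubic x1 - C) - M * p * (d * cubic' x1)
        + M * M * ((- d * p) ^ 2 * (27 * x1 - 9 + 9 * (M * (- d * p))))); [ring |].
      rewrite hp. replace (d * cubic' x1) with (1 + 7 * u) by lia.
      rewrite HM at 3. ring.
Qed.

Lemma cubic_congr (q x y : Z) : (q | x - y) -> (q | cubic x - cubic y).
Proof.
  intros [u hu]. replace x with (y + u * q) by lia. rewrite cubic_shift.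
  exists (u * cubic' y + u * (u * q) * (27 * y - 9 + 9 * (u * q))). ring.
Qed.

Lemma cubic'_congr (q x y : Z) : (q | x - y) -> (q | cubic' x - cubic' y).
Proof.
  intros [u hu]. replace x with (y + u * q) by lia. rewrite cubic'_shift.
  exists (u * cubic'' y + u * (u * q) * 27). ring.
Qed.

(** For each class of [c] modulo 7 there is a nonsingular solution of the two equations
    with [g = 127] or [g = 136].  These values are congruent to one modulo 9, as the
    condition modulo 9 requires later, and have the residue modulo 7 that the solution needs. *)
Lemma starting_pair (c : Z) (i : nat) : exists x y g,
  100 <= g <= 145 /\ (9 | g - 1) /\
    (7 ^ Z.of_nat (S i) | cubic x + cubic y - 2 * c) /\
    (7 ^ Z.of_nat (S i) | cubic' y - g * cubic' x).
Proof.
  assert (H : exists x0 y0 g d,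
    (100 <= g <= 145 /\ (9 | g - 1)) /\ (7 | cubic x0 + cubic y0 - 2 * c) /\
    (7 | cubic' y0 - g * cubic' x0) /\
    (7 | d * (cubic' x0 * cubic'' y0 + g * cubic' y0 * cubic'' x0) - 1)).
  { pose proof (Z.div_mod c 7 ltac:(lia)) as E.
    pose proof (Z.mod_pos_bound c 7 ltac:(lia)) as B.
    set (w := c / 7) in *. set (r := c mod 7) in *. clearbody w r. subst c.
    assert (R : r = 0 \/ r = 1 \/ r = 2 \/ r = 3 \/ r = 4 \/ r = 5 \/ r = 6) by lia.
    assert (dvd : forall z, z mod 7 = 0 -> (7 | z)) by (intros; now apply Z.mod_divide).
    assert (dvd' : forall z, (7 | z) -> (7 | z - 14 * w)).
    { intros z hz. apply Z.divide_sub_r; [assumption | exists (2 * w); ring]. }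
    assert (first : forall z, (7 | z - 2 * r) -> (7 | z - 2 * (7 * w + r))).
    { intros z hz. replace (z - 2 * (7 * w + r)) with (z - 2 * r - 14 * w) by ring. auto. }
    destruct R as [-> | [-> | [-> | [-> | [-> | [-> | ->]]]]]].
    - exists 0, 0, 127, 3. repeat split; [lia | lia | now apply Z.mod_divide | apply first | |]; now apply dvd.
    - exists 6, 6, 127, 1. repeat split; [lia | lia | now apply Z.mod_divide | apply first | |]; now apply dvd.
    - exists 1, 1, 127, 1. repeat split; [lia | lia | now apply Z.mod_divide | apply first | |]; now apply dvd.
    - exists 2, 6, 136, 3. repeat split; [lia | lia | now apply Z.mod_divide | apply first | |]; now apply dvd.
    - exists 1, 4, 136, 4. repeat split; [lia | lia | now apply Z.mod_divide | apply first | |]; now apply dvd.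
    - exists 2, 2, 127, 6. repeat split; [lia | lia | now apply Z.mod_divide | apply first | |]; now apply dvd.
    - exists 4, 4, 127, 6. repeat split; [lia | lia | now apply Z.mod_divide | apply first | |]; now apply dvd.
  }
  destruct H as (x0 & y0 & g & d & [h1 h2] & h3 & h4 & h5).
  destruct (hensel_two_equations _ _ _ _ _ h3 h4 h5 i) as (x & y & h6 & h7).
  now exists x, y, g.
Qed.

Lemma dodecahedral_mod9 (n : Z) : (9 | dodecahedral n - n).
Proof.
  apply Gauss with 2; [| now apply Zgcd_1_rel_prime].
  exists (n ^ 3 - n ^ 2).
  replace (2 * (dodecahedral n - n)) with (cubic n - 2 * n) by (rewrite cubic_double; ring).
  unfold cubic. ring.
Qed.

(** Let [s = 7 ^ k] and [Q = s / 7 ^ 7].  Modulo [s] the polynomial is linear in a shift by a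
    multiple of [Q], with slope determined modulo [7 ^ 7].  The slope at [y] is [g] times the
    slope at [n0], so moving the second index by [Q t] is compensated by moving the first one
    by [- g Q t].  Modulo 9 a dodecahedral number is congruent to its index, so [g = 1 mod 9]
    makes the same move harmless there, and a multiple of [s] adjusts the class of [n0]. *)
Lemma progression_of_pairs (c : Z) (k : nat) : (14 <= k)%nat -> exists n0 y g,
  100 <= g <= 145 /\ 1 <= y <= 7 ^ 7 /\
  forall t i,
    (9 * 7 ^ Z.of_nat k | dodecahedral (n0 - g * 7 ^ (Z.of_nat k - 7) * t + 9 * 7 ^ Z.of_nat k * i)
      + dodecahedral (y + 7 ^ (Z.of_nat k - 7) * t) - c).
Proof.
  intros hk.
  destruct (starting_pair c 6) as (x & y0 & g & hg & g9 & h1 & h2).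
  change (7 ^ Z.of_nat 7) with (7 ^ 7) in h1, h2.
  assert (q0 : 0 < 7 ^ 7) by (now apply Z.pow_pos_nonneg).
  set (q := 7 ^ 7) in *.
  set (y := (y0 - 1) mod q + 1).
  assert (hy : 1 <= y <= q).
  { pose proof (Z.mod_pos_bound (y0 - 1) q q0). unfold y. lia. }
  assert (hyy : (q | y - y0)).
  { exists (- ((y0 - 1) / q)). pose proof (Z.div_mod (y0 - 1) q ltac:(lia)). unfold y. lia. }
  assert (h1' : (q | cubic x - (2 * c - cubic y))).
  { replace (cubic x - (2 * c - cubic y)) with
      ((cubic x + cubic y0 - 2 * c) + (cubic y - cubic y0)) by ring.
    apply Z.divide_add_r; [assumption | now apply cubic_congr]. }
  destruct (hensel_lift _ _ 6 h1' (k - 7)) as (n1 & h3 & h4).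
  change (7 ^ Z.of_nat 7) with q in h3.
  replace (Z.of_nat 7 + Z.of_nat (k - 7)) with (Z.of_nat k) in h4 by lia.
  assert (hs : 7 ^ Z.of_nat k = q * 7 ^ (Z.of_nat k - 7)).
  { unfold q. rewrite <- Z.pow_add_r by lia. f_equal. lia. }
  assert (hQ : 7 ^ (Z.of_nat k - 7) = q * 7 ^ (Z.of_nat k - 14)).
  { unfold q. rewrite <- Z.pow_add_r by lia. f_equal. lia. }
  assert (cop : rel_prime 9 (7 ^ Z.of_nat k)).
  { apply rel_prime_Zpower_r; [lia | now apply Zgcd_1_rel_prime]. }
  assert (cop2 : rel_prime (7 ^ Z.of_nat k) 2).
  { apply rel_prime_sym, rel_prime_Zpower_r; [lia | now apply Zgcd_1_rel_prime]. }
  set (s := 7 ^ Z.of_nat k) in *. set (Q := 7 ^ (Z.of_nat k - 7)) in *.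
  set (Q' := 7 ^ (Z.of_nat k - 14)) in *. clearbody s Q Q'.
  assert (h5 : (q | cubic' y - g * cubic' n1)).
  { replace (cubic' y - g * cubic' n1) with
      ((cubic' y0 - g * cubic' x) + ((cubic' y - cubic' y0) - g * (cubic' n1 - cubic' x))) by ring.
    apply Z.divide_add_r; [assumption |].
    apply Z.divide_sub_r; [now apply cubic'_congr |].
    apply Z.divide_mul_r. now apply cubic'_congr. }
  destruct (rel_prime_bezout _ _ cop) as [v s' bz].
  set (j := s' * (c - n1 - y)).
  exists (n1 + s * j), y, g. do 2 (split; [assumption |]). intros t i.
  set (H := q * (j + 9 * i) - g * t).
  replace (n1 + s * j - g * Q * t + 9 * s * i) with (n1 + Q * H)
    by (unfold H; rewrite hs; ring).
  assert (D9 : (9 | dodecahedral (n1 + Q * H) + dodecahedral (y + Q * t) - c)).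
  { destruct (dodecahedral_mod9 (n1 + Q * H)) as [u1 h6].
    destruct (dodecahedral_mod9 (y + Q * t)) as [u2 h7].
    destruct g9 as [u3 h8].
    exists (u1 + u2 - Q * u3 * t + s * i + (n1 + y - c) * v).
    assert (E : n1 + y - c + s * j = (n1 + y - c) * (v * 9)).
    { unfold j. replace (v * 9) with (1 - s' * s) by lia. ring. }
    transitivity (u1 * 9 + u2 * 9 + (n1 + y - c + s * j) + 9 * s * i - Q * (g - 1) * t).
    - rewrite <- h6, <- h7. unfold H. rewrite hs. ring.
    - rewrite E, h8. ring. }
  assert (Ds : (s | dodecahedral (n1 + Q * H) + dodecahedral (y + Q * t) - c)).
  { apply Gauss with 2.
    - replace (2 * (dodecahedral (n1 + Q * H) + dodecahedral (y + Q * t) - c))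
        with (cubic (n1 + Q * H) + cubic (y + Q * t) - 2 * c) by (rewrite !cubic_double; ring).
      rewrite !cubic_shift.
      destruct h4 as [u hu]. destruct h5 as [e he].
      exists (u + (j + 9 * i) * cubic' n1 + t * e
        + Q' * (H ^ 2 * (27 * n1 - 9 + 9 * (Q * H)) + t ^ 2 * (27 * y - 9 + 9 * (Q * t)))).
      transitivity ((cubic n1 - (2 * c - cubic y)) + Q * (q * (j + 9 * i) * cubic' n1 + t * (cubic' y - g * cubic' n1))
        + Q * Q * (H ^ 2 * (27 * n1 - 9 + 9 * (Q * H)) + t ^ 2 * (27 * y - 9 + 9 * (Q * t)))).
      + unfold H. ring.
      + rewrite hu, he. rewrite hQ at 2. rewrite hs. ring.
    - assumption. }
  destruct D9 as [u1 h6], Ds as [u2 h7].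
  set (D := dodecahedral _ + _ - c) in *.
  exists (u2 * v + u1 * s').
  transitivity (D * (v * 9 + s' * s)); [rewrite bz; ring |].
  transitivity (D * v * 9 + D * s' * s); [ring |].
  rewrite h7 at 1. rewrite h6. ring.
Qed.

(** * Placing the two free summands *)

Lemma power_bracket (b m : Z) : 1 < b -> 1 <= m ->
  exists k : nat, b ^ Z.of_nat k <= m < b ^ (Z.of_nat k + 1).
Proof.
  intros hb hm.
  assert (H : forall n : nat, m < b ^ Z.of_nat n ->
    exists k : nat, b ^ Z.of_nat k <= m < b ^ (Z.of_nat k + 1)).
  { intros n. induction n as [|n IH]; intros h.
    - simpl in h. lia.
    - destruct (Z_lt_le_dec m (b ^ Z.of_nat n)) as [h1 | h1]; [auto |].
      exists n. split; [assumption |].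
      rewrite Nat2Z.inj_succ in h. assumption. }
  apply (H (Z.to_nat m)). rewrite Z2Nat.id by lia.
  apply Z.pow_gt_lin_r; lia.
Qed.

Lemma cubic_monotone (a b : Z) : 0 <= a <= b -> cubic a <= cubic b.
Proof.
  intros [h1 h2]. replace b with (a + (b - a)) by ring.
  set (h := b - a). assert (0 <= h) by (unfold h; lia). clearbody h. clear h2.
  rewrite cubic_shift. unfold cubic'.
  destruct (Z.eq_dec h 0) as [-> | hh]; [lia |].
  assert (0 <= 27 * a ^ 2 - 18 * a + 2 + h * (27 * a - 9 + 9 * h)).
  { assert (27 * a <= 27 * (h * a)) by nia.
    assert (0 <= a ^ 2) by nia.
    assert (a <= a ^ 2) by nia. nia. }
  nia.
Qed.

Lemma cubic_lower (n : Z) : 0 <= n -> 9 * (n - 1) * n ^ 2 <= cubic n.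
Proof. intros h. unfold cubic. nia. Qed.

Lemma last_below (X : Z) : 0 < X -> exists B, 0 <= B /\ 2 * cubic B < X <= 2 * cubic (B + 1).
Proof.
  intros hX.
  assert (H : forall n : nat, X <= 2 * cubic (Z.of_nat n) ->
    exists B, 0 <= B /\ 2 * cubic B < X <= 2 * cubic (B + 1)).
  { intros n. induction n as [|n IH]; intros h.
    - change (cubic (Z.of_nat 0)) with 0 in h. lia.
    - destruct (Z_lt_le_dec (2 * cubic (Z.of_nat n)) X) as [h1 | h1]; [| auto].
      exists (Z.of_nat n). replace (Z.of_nat n + 1) with (Z.of_nat (S n)) by lia. lia. }
  apply (H (Z.to_nat (X + 1))). rewrite Z2Nat.id by lia.
  assert (h : 9 * (X + 1 - 1) * (X + 1) ^ 2 <= cubic (X + 1)) by (apply cubic_lower; lia).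
  nia.
Qed.

(** The main term is [3 * 9 * B ^ 2 * h], at most [0.135 * s ^ 3]. *)
Lemma cubic_increment (s B h : Z) : 0 < s -> 0 <= B <= 5 * s -> 0 <= h -> 5000 * h <= s ->
  50 * (cubic (B + h) - cubic B) <= 7 * s ^ 3 + s.
Proof.
  intros hs hB hh hhs.
  rewrite cubic_shift. unfold cubic'.
  assert (H1 : B ^ 2 <= 25 * s ^ 2) by nia.
  assert (H2 : 5000 * (h * B ^ 2) <= 25 * s ^ 3).
  { assert (5000 * h * B ^ 2 <= s * (25 * s ^ 2)) by (apply Z.mul_le_mono_nonneg; nia). lia. }
  assert (H3 : 25000000 * h ^ 2 <= s ^ 2) by nia.
  assert (H4 : 25000000 * (h ^ 2 * B) <= 5 * s ^ 3).
  { assert (25000000 * h ^ 2 * B <= s ^ 2 * (5 * s)) by (apply Z.mul_le_mono_nonneg; nia). lia. }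
  assert (H5 : 25000000 * 5000 * h ^ 3 <= s ^ 3).
  { assert (25000000 * h ^ 2 * (5000 * h) <= s ^ 2 * s) by (apply Z.mul_le_mono_nonneg; nia). lia. }
  assert (H6 : 0 <= h * B) by nia.
  assert (H7 : 0 <= h ^ 2) by nia.
  lia.
Qed.

(** As [t] grows by one the first index moves by [g Q < s / 5000] only; at most [9 s / (g Q)]
    steps cross a full period [9 s], and they bring the second index to at most
    [7 ^ 7 + 9 s / g], where [g >= 100]. *)
Lemma reach_window (s Q g y n0 A : Z) :
  s = 823543 * Q -> 10 ^ 12 <= s -> 100 <= g <= 145 -> 1 <= y <= 823543 ->
  exists t i, A <= n0 - g * Q * t + 9 * s * i < A + g * Q /\
    0 < y + Q * t /\ 11 * (y + Q * t) <= s.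
Proof.
  intros hs big hg hy.
  assert (Q0 : 0 < Q) by lia.
  assert (gQ : 0 < g * Q) by (apply Z.mul_pos_pos; lia).
  pose proof (Z.div_mod (n0 - A) (9 * s) ltac:(lia)) as Ei.
  pose proof (Z.mod_pos_bound (n0 - A) (9 * s) ltac:(lia)) as Bi.
  set (i := (n0 - A) / (9 * s)) in *.
  set (r := (n0 - A) mod (9 * s)) in *.
  pose proof (Z.div_mod r (g * Q) ltac:(lia)) as Et.
  pose proof (Z.mod_pos_bound r (g * Q) gQ) as Bt.
  assert (ht : 0 <= r / (g * Q)) by (apply Z.div_pos; lia).
  set (t := r / (g * Q)) in *.
  set (r' := r mod (g * Q)) in *.
  clearbody i t r r'.
  exists t, (- i). split; [| split].
  - replace (9 * s * - i) with (- (9 * s * i)) by ring. lia.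
  - assert (0 <= Q * t) by (apply Z.mul_nonneg_nonneg; lia). lia.
  - assert (0 <= (g - 100) * (Q * t)).
    { apply Z.mul_nonneg_nonneg; [lia |]. apply Z.mul_nonneg_nonneg; lia. }
    assert (g * Q * t = (g - 100) * (Q * t) + 100 * (Q * t)) by ring.
    lia.
Qed.

(** The index [B + 1] is the first one for which the remainder is at most
    [s ^ 3 / 4 - s ^ 2], just below the upper end of the interval served by [six_dodecahedral].  Passing [B] by at most
    [s / 5000] costs about [0.07 * s ^ 3] because [B <= 5 s], and the small index [n'] costs at most
    [s ^ 3 / 72]; the lower end is [s ^ 3 / 8]. *)
Lemma window_estimates (m s h B n n' : Z) :
  10 ^ 12 <= s -> s ^ 3 <= m < 343 * s ^ 3 -> 0 <= h -> 5000 * h <= s -> 0 <= B ->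
  2 * cubic B < 4 * m - s ^ 3 + 4 * s ^ 2 <= 2 * cubic (B + 1) ->
  B + 1 <= n < B + 1 + h -> 0 < n' -> 11 * n' <= s ->
  s ^ 3 + 23 * s <= 8 * m - 4 * cubic n - 4 * cubic n' <= 2 * s ^ 3 - 8 * s ^ 2.
Proof.
  intros big [m1 m2] h0 hs hB [hB1 hB2] [hn1 hn2] hn'0 hn'.
  assert (Hn1 : cubic (B + 1) <= cubic n) by (apply cubic_monotone; lia).
  assert (Hn2 : cubic n <= cubic (B + h)) by (apply cubic_monotone; lia).
  assert (Hn'0 : cubic 0 <= cubic n') by (apply cubic_monotone; lia).
  change (cubic 0) with 0 in Hn'0.
  assert (Hn' : 36 * cubic n' <= s ^ 3).
  { assert (h1 : cubic n' <= 9 * n' ^ 3).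
    { unfold cubic. assert (n' <= n' ^ 2) by (clear - hn'0; nia). lia. }
    assert (h2 : (11 * n') ^ 3 <= s ^ 3) by (apply Z.pow_le_mono_l; lia).
    assert (h3 : (11 * n') ^ 3 = 1331 * n' ^ 3) by ring.
    assert (0 <= n' ^ 3) by (apply Z.pow_nonneg; lia). lia. }
  assert (s2 : s <= s ^ 2) by (clear - big; nia).
  assert (s3 : 10 ^ 12 * s ^ 2 <= s ^ 3).
  { replace (s ^ 3) with (s * s ^ 2) by ring. apply Z.mul_le_mono_nonneg_r; lia. }
  assert (hB5 : B <= 5 * s).
  { destruct (Z_le_gt_dec B (5 * s)) as [|hgt]; [assumption | exfalso].
    assert (h1 : cubic (5 * s) <= cubic B) by (apply cubic_monotone; lia).
    assert (h2 : cubic (5 * s) = 1125 * s ^ 3 - 225 * s ^ 2 + 10 * s) by (unfold cubic; ring).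
    lia. }
  assert (Hinc : 50 * (cubic (B + h) - cubic B) <= 7 * s ^ 3 + s).
  { apply cubic_increment; lia. }
  lia.
Qed.

Theorem theorem1p6 (m : Z) (hm : 0 < m) (hm39 : 10 ^ 39 <= m) :
  sum_of_dodecahedral 8 m.
Proof.
  destruct (power_bracket (7 ^ 3) m) as (k & hk1 & hk2); [reflexivity | lia |].
  rewrite <- Z.pow_mul_r in hk1, hk2 by lia.
  (* The lower bound on [m] makes [s] exceed [10 ^ 12] and [Q] divisible by [7 ^ 7]. *)
  assert (k15 : (15 <= k)%nat).
  { destruct (Nat.le_gt_cases 15 k) as [|hlt]; [assumption | exfalso].
    assert (7 ^ (3 * (Z.of_nat k + 1)) <= 7 ^ 45) by (apply Z.pow_le_mono_r; lia).
    assert (7 ^ 45 < 10 ^ 39) by (vm_compute; reflexivity). lia. }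
  assert (big : 10 ^ 12 <= 7 ^ Z.of_nat k).
  { apply Z.le_trans with (7 ^ 15); [vm_compute; discriminate |].
    apply Z.pow_le_mono_r; lia. }
  assert (m12 : (7 ^ Z.of_nat k) ^ 3 <= m < 343 * (7 ^ Z.of_nat k) ^ 3).
  { rewrite <- Z.pow_mul_r by lia. split.
    - now replace (Z.of_nat k * 3) with (3 * Z.of_nat k) by ring.
    - change 343 with (7 ^ 3). rewrite <- Z.pow_add_r by lia.
      now replace (3 + Z.of_nat k * 3) with (3 * (Z.of_nat k + 1)) by ring. }
  assert (hs6 : exists a, 7 ^ Z.of_nat k = 6 * a + 1).
  { clear. induction k as [|k [a IH]]; [now exists 0 |].
    exists (7 * a + 1). rewrite Nat2Z.inj_succ, Z.pow_succ_r, IH by lia. ring. }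
  assert (hsQ : 7 ^ Z.of_nat k = 823543 * 7 ^ (Z.of_nat k - 7)).
  { change 823543 with (7 ^ 7). rewrite <- Z.pow_add_r by lia. f_equal. lia. }
  destruct hs6 as [a ha].
  (* [w] is the least value of three pairs; dividing by 8 is exact because [s] is odd. *)
  assert (hw : exists w, 8 * w = (6 * a + 1) ^ 3 + 23 * (6 * a + 1)).
  { destruct (Z.Even_or_Odd a) as [[b ->] | [b ->]].
    - exists (216 * b ^ 3 + 54 * b ^ 2 + 39 * b + 3). ring.
    - exists (27 * (2 * b + 1) ^ 3 + 54 * b ^ 2 + 93 * b + 36). ring. }
  destruct hw as [w hw].
  destruct (progression_of_pairs (m - w) k) as (n0 & y & g & hg & hy & Hprog); [lia |].
  change (7 ^ 7) with 823543 in hy.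
  rewrite ha in *.
  set (Q := 7 ^ (Z.of_nat k - 7)) in *. clearbody Q. clear hk1 hk2 k15 ha k.
  remember (6 * a + 1) as s eqn:hs.
  assert (s2 : 0 <= s ^ 2) by (apply Z.pow_nonneg; lia).
  assert (s3 : 0 <= s ^ 3) by (apply Z.pow_nonneg; lia).
  destruct (last_below (4 * m - s ^ 3 + 4 * s ^ 2)) as (B & hB & hB12); [lia |].
  destruct (reach_window s Q g y n0 (B + 1) hsQ big hg hy) as (t & i & hn & hn'0 & hn').
  destruct (Hprog t i) as [T hT]. clear Hprog.
  set (n := n0 - g * Q * t + 9 * s * i) in *. set (n' := y + Q * t) in *.
  clearbody n n'.
  assert (h0 : 0 <= g * Q) by (apply Z.mul_nonneg_nonneg; lia).
  assert (hgs : 5000 * (g * Q) <= s).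
  { assert (g * Q <= 145 * Q) by (apply Z.mul_le_mono_nonneg_r; lia). lia. }
  destruct (window_estimates m s (g * Q) B n n' big m12 h0 hgs hB hB12 hn hn'0 hn') as [e1 e2].
  rewrite !cubic_double in e1, e2.
  assert (hsT : 8 * m - 8 * dodecahedral n - 8 * dodecahedral n' - s ^ 3 - 23 * s = 72 * (s * - T))
    by lia.
  (* [T] measures by how much the two free summands exceed [m - w]. *)
  destruct (six_dodecahedral a (- T))
    as (n1 & n2 & n3 & n4 & n5 & n6 & p1 & p2 & p3 & p4 & p5 & p6 & E).
  - lia.
  - apply (Z.mul_le_mono_pos_l _ _ s); lia.
  - apply (Z.mul_le_mono_pos_l _ _ s); [lia |].
    replace (s * (6 * a - 3) ^ 2) with (s ^ 3 - 8 * s ^ 2 + 16 * s) by (rewrite hs; ring).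
    lia.
  - rewrite <- hs in E.
    exists (n :: n' :: n1 :: n2 :: n3 :: n4 :: n5 :: n6 :: nil)%list. split; [reflexivity |]. split.
    + assert (0 < n) by lia. repeat constructor; tauto.
    + simpl. lia.
Qed.
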